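(* The problem $1\,||\,\sum w_jU_j$ can be solved in $\widetilde{O}(n+d_{\#}d_{\max}^2)$ time.
   Context: In the problem $1\,||\,\sum w_jU_j$ we are given $n$ jobs $J=\{1,\ldots,n\}$, each job $j$ having a processing time $p_j\in\mathbb{N}$, a weight $w_j\in\mathbb{N}$ and a due date $d_j\in\mathbb{N}$. A schedule is a permutation $\sigma$ of the jobs processed non-preemptively on a single machine; the completion time of $j$ is $C_j=\sum_{i:\sigma(i)\le\sigma(j)}p_i$, and $j$ is tardy if $C_j>d_j$ and early otherwise. The goal is to compute the minimum, over all schedules, of the total weight of tardy jobs. Parameters: $n$ is the number of jobs, $d_{\max}=\max_j d_j$, and $d_{\#}=|\{d_j : j\in J\}|$ is the number of distinct due dates. $\widetilde{O}$ suppresses polylogarithmic factors. *)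

(* Defs.v *)
From mathcomp Require Import all_boot.
Set Implicit Arguments. Unset Strict Implicit. Unset Printing Implicit Defensive.

(* a job is (p_j, w_j, d_j) : processing time, weight, due date *)
Definition job := (nat * nat * nat)%type.
Definition jp (j : job) := j.1.1.
Definition jw (j : job) := j.1.2.
Definition jd (j : job) := j.2.

Fixpoint tardy_weight_from (t : nat) (s : seq job) : nat :=
  match s with
  | [::] => 0
  | j :: s' => (if t + jp j > jd j then jw j else 0) + tardy_weight_from (t + jp j) s'
  end.
Definition tardy_weight (s : seq job) := tardy_weight_from 0 s.

Definition is_schedule (J s : seq job) := perm_eq s J.

Definition is_opt (J : seq job) (o : nat) : Prop :=
  (exists s, is_schedule J s /\ tardy_weight s = o) /\
  (forall s, is_schedule J s -> o <= tardy_weight s).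

Definition dmax (J : seq job) : nat := \max_(j <- J) jd j.
Definition dnum (J : seq job) : nat := size (undup (map jd J)).
Definition maxval (J : seq job) : nat := \max_(j <- J) maxn (jp j) (maxn (jw j) (jd j)).

Inductive instr :=
| Halt
| Const (dst val : nat)
| Add (dst a b : nat)
| Sub (dst a b : nat)            (* truncated subtraction *)
| Mul (dst a b : nat)
| Div (dst a b : nat)            (* M[a] %/ M[b], x %/ 0 = 0 *)
| Mod (dst a b : nat)            (* M[a] %% M[b], x %% 0 = x *)
| Lt  (dst a b : nat)
| Ld (dst a : nat)
| St (a src : nat)
| Jz (a target : nat)
| Jmp (target : nat).

Definition memory := nat -> nat.
Definition upd (M : memory) (a v : nat) : memory := fun i => if i == a then v else M i.

Definition step (B : nat) (i : instr) (pc : nat) (M : memory) : option (nat * memory) :=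
  let wr a v := if v < B then Some (pc.+1, upd M a v) else None in
  match i with
  | Halt => Some (pc, M)
  | Const d v => wr d v
  | Add d a b => wr d (M a + M b)
  | Sub d a b => wr d (M a - M b)
  | Mul d a b => wr d (M a * M b)
  | Div d a b => wr d (M a %/ M b)
  | Mod d a b => wr d (M a %% M b)
  | Lt d a b => wr d (nat_of_bool (M a < M b))
  | Ld d a => wr d (M (M a))
  | St a s => wr (M a) (M s)
  | Jz a t => Some (if M a == 0 then t else pc.+1, M)
  | Jmp t => Some (t, M)
  end.

(* run program P for at most [fuel] steps; Some M' if it halts (reaches a
   Halt instruction or leaves the program) within [fuel] steps without fault. *)
Fixpoint run (B : nat) (P : seq instr) (fuel pc : nat) (M : memory) : option memory :=
  match nth Halt P pc with
  | Halt => Some M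
  | i => match fuel with
         | 0 => None
         | fuel'.+1 => match step B i pc M with
                       | Some (pc', M') => run B P fuel' pc' M'
                       | None => None
                       end
         end
  end.

(* input encoding: M[0] = n, M[3j+1] = p_j, M[3j+2] = w_j, M[3j+3] = d_j *)
Definition init_mem (J : seq job) : memory := fun i =>
  if i == 0 then size J else
  let j := (i.-1) %/ 3 in let r := (i.-1) %% 3 in
  let x := nth (0, 0, 0) J j in
  if j < size J then (if r == 0 then jp x else if r == 1 then jw x else jd x) else 0.

(* word size Theta(log N), N = n + largest input number: values < N^c *)
Definition word_bound (c : nat) (J : seq job) : nat := (size J + maxval J + 2) ^ c.

(* Main.v *)
Require Import Defs.
From mathcomp Require Import all_boot zify.
Set Implicit Arguments. Unset Strict Implicit. Unset Printing Implicit Defensive.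

(* A set of jobs can be completed in time iff, for every x, its jobs due by x have
   total processing time at most x.  Hence among the jobs with the same (p, d) only
   the [d %/ p] heaviest matter, and a harmonic sum leaves O(dmax log dmax) jobs
   per due date.  The heaviest jobs are found by extracting all jobs in order of
   decreasing weight from a tournament tree, in O(n log n); the survivors are
   processed by increasing due date with the Lawler-Moore recursion
   F[t] := max (F[t], F[min(t, d) - p] + w), in O(dmax) time per job.

   The RAM program is obtained from a small imperative language by a compiler
   whose simulation theorem [compC_steps] preserves time up to a constant. *)

(** * A compiler from while programs to the RAM *)

(** The time bound contains no logarithm of the weights and nothing forces weights to be comparable
    to [dmax], so the order by weight is paid for by comparisons, [n log n] of them; the order by
    due date is a bucket sort over the dates [0 .. dmax]. Visiting dates that are nobody's due date
    costs O(dmax), which is at most a constant times [dnum * dmax ^ 2] once there is a job. The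
    table counting the kept jobs of each pair (d, p) has about [dmax ^ 2] cells, but memory beyond
    the input is zero, so neither this table nor the array [F] is ever initialised. Dropping the
    lighter jobs is justified by an exchange: a feasible set contains at most [d %/ p] jobs of a
    class, so a dropped member can be traded for a kept one that is at least as heavy and not yet
    used, and no load changes. Jobs with [p = 0] stay outside all this: started at time 0 they are
    early whatever their due date. *)

Inductive steps (B : nat) (P : seq instr) : nat -> nat * memory -> nat * memory -> Prop :=
| steps_refl c : steps B P 0 c c
| steps_step k pc M c1 c2 : nth Halt P pc <> Halt ->
    step B (nth Halt P pc) pc M = Some c1 -> steps B P k c1 c2 ->
    steps B P k.+1 (pc, M) c2.

Lemma steps_trans B P k1 k2 c1 c2 c3 :
  steps B P k1 c1 c2 -> steps B P k2 c2 c3 -> steps B P (k1 + k2) c1 c3.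
Proof.
elim=> [c|k pc M c c' nH st _ IH] h2; first by rewrite add0n.
by rewrite addSn; apply: steps_step nH st (IH h2).
Qed.

Lemma step_bounded B i pc M pc' M' : (forall a, M a < B) ->
  step B i pc M = Some (pc', M') -> forall a, M' a < B.
Proof.
move=> hM; have hw d v : (if v < B then Some (pc.+1, upd M d v) else None) = Some (pc', M') ->
    forall a, M' a < B.
  by case: ifP => // hv [_ <-] a; rewrite /upd; case: eqP.
case: i => /= *; try (by apply: hw; eassumption);
  by match goal with h : Some _ = Some _ |- _ => case: h => _ <- end.
Qed.

Lemma steps_bounded B P k c c' : steps B P k c c' ->
  (forall a, c.2 a < B) -> forall a, c'.2 a < B.
Proof.
elim=> // {}k pc M [pc1 M1] c2 _ st _ IH hM; apply: IH => /=.
exact: step_bounded hM st.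
Qed.

Lemma step_mono B B' i pc M c : B <= B' ->
  step B i pc M = Some c -> step B' i pc M = Some c.
Proof.
move=> hB; have hw d v : (if v < B then Some (pc.+1, upd M d v) else None) = Some c ->
    (if v < B' then Some (pc.+1, upd M d v) else None) = Some c.
  by case: ifP => // hv; rewrite (leq_trans hv hB).
by case: i => /= *; try (by apply: hw; eassumption).
Qed.

(** The relocation of the input is analysed under the value bound [V], which shows that all cells
    are below [V] when the compiled code starts; its run is then transferred to the larger word
    bound [B], which has room for addresses. *)
Lemma steps_mono B B' P k c c' : B <= B' -> steps B P k c c' -> steps B' P k c c'.
Proof.
move=> hB; elim=> [?|{}k pc M c1 c2 nH st _ IH]; first exact: steps_refl.
exact: steps_step nH (step_mono hB st) IH.
Qed.

Lemma run_steps B P k c pc' M' fuel : steps B P k c (pc', M') ->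
  nth Halt P pc' = Halt -> k <= fuel -> run B P fuel c.1 c.2 = Some M'.
Proof.
move E: (pc', M') => c' h; elim: h fuel E => [c0|{}k pc M [pc1 M1] c2 nH st _ IH] fuel E hH hk.
  by case: c0 E => a b [<- <-] /=; case: fuel {hk} => [|f] /=; rewrite hH.
case: fuel hk => // f hk.
(* [run] matches on the instruction before the fuel, so its recursive branch appears only after a
   case analysis on the instruction. *)
have -> : run B P f.+1 pc M =
    if step B (nth Halt P pc) pc M is Some (pc', M') then run B P f pc' M' else None.
  by move=> /=; case: (nth Halt P pc) nH.
by rewrite st; apply: IH.
Qed.

Definition code_at (P : seq instr) (pc : nat) (code : seq instr) :=
  forall i, i < size code -> nth Halt P (pc + i) = nth Halt code i.

Lemma code_at_cat P pc c1 c2 : code_at P pc (c1 ++ c2) ->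
  code_at P pc c1 /\ code_at P (pc + size c1) c2.
Proof.
move=> h; split=> i hi.
  by rewrite h ?size_cat ?nth_cat ?hi //; lia.
rewrite -addnA h ?size_cat ?nth_cat; last lia.
by rewrite ifF; [congr nth; lia | lia].
Qed.

Lemma code_at_cons P pc i c : code_at P pc (i :: c) ->
  nth Halt P pc = i /\ code_at P pc.+1 c.
Proof.
rewrite -cat1s => /code_at_cat [h1 h2]; split; last by rewrite -addn1.
by have := h1 0 isT; rewrite addn0.
Qed.

Definition straight (i : instr) :=
  match i with Halt | Jz _ _ | Jmp _ => false | _ => true end.

(** Straight-line code does not depend on the program counter, so it is executed at the dummy
    counter 0, as a partial function on memories. *)
Fixpoint run_block (B : nat) (code : seq instr) (M : memory) : option memory :=
  if code is i :: code' then
    if straight i then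
      if step B i 0 M is Some (_, M') then run_block B code' M' else None
    else None
  else Some M.

Lemma run_block_cat B c1 c2 M M1 : run_block B c1 M = Some M1 ->
  run_block B (c1 ++ c2) M = run_block B c2 M1.
Proof.
elim: c1 M => [|i c1 IH] M /=; first by case=> ->.
by case: straight => //; case: step => // -[_ M'] /IH.
Qed.

Lemma run_block_steps B P pc code M M' : code_at P pc code ->
  run_block B code M = Some M' ->
  steps B P (size code) (pc, M) (pc + size code, M').
Proof.
elim: code pc M => [|i code IH] pc M /=.
  by move=> _ [<-]; rewrite addn0; apply: steps_refl.
move=> /code_at_cons [hi hc]; case hs: straight => //.
case st: (step B i 0 M) => [[q M1]|] // /(IH _ _ hc) h.
rewrite -addSnnS; apply: (steps_step (c1 := (pc.+1, M1))) h; rewrite hi.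
  by case: i hs {hi st}.
have hw d v : (if v < B then Some (1, upd M d v) else None) = Some (q, M1) ->
    (if v < B then Some (pc.+1, upd M d v) else None) = Some (pc.+1, M1).
  by case: ifP => // _ [_ ->].
by case: i hs st {hi} => //= *; apply: hw.
Qed.

(** * While programs: syntax, timed semantics and compilation *)

Inductive bop := BAdd | BSub | BMul | BDiv | BLt.

Definition bop_eval (o : bop) (x y : nat) : nat :=
  match o with
  | BAdd => x + y | BSub => x - y | BMul => x * y
  | BDiv => x %/ y | BLt => x < y
  end.

Definition bop_instr (o : bop) : nat -> nat -> nat -> instr :=
  match o with
  | BAdd => Add | BSub => Defs.Sub | BMul => Mul
  | BDiv => Div | BLt => Lt
  end.

Inductive expr :=
| EC of nat
| EV of nat
| EA of nat & expr
| EB of bop & expr & expr.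

Inductive cmd :=
| Skip
| Asg of nat & expr
| Sto of nat & expr & expr
| Seq of cmd & cmd
| If of expr & cmd & cmd
| While of expr & cmd.

Record state := State { vr : nat -> nat; ar : nat -> nat -> nat }.

Definition setv s x v := State (fun y => if y == x then v else vr s y) (ar s).
Definition seta s a i v :=
  State (vr s) (fun b j => if (b == a) && (j == i) then v else ar s b j).

Fixpoint eval (s : state) (e : expr) : nat :=
  match e with
  | EC v => v
  | EV x => vr s x
  | EA a e => ar s a (eval s e)
  | EB o e1 e2 => bop_eval o (eval s e1) (eval s e2)
  end.

(* Only sums and products can leave the range of values already known to be
   below [V], so only they carry an overflow condition. *)
Fixpoint ok (V : nat) (s : state) (e : expr) : Prop :=
  match e with
  | EC _ | EV _ => True
  | EA _ e => ok V s e
  | EB o e1 e2 => ok V s e1 /\ ok V s e2 /\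
      match o with BAdd | BMul => bop_eval o (eval s e1) (eval s e2) < V | _ => True end
  end.

(* Time counts assignments and tests only: [compC_steps] charges each of them
   the size of the whole compiled program. *)
Inductive ev (V : nat) : cmd -> state -> nat -> state -> Prop :=
| ev_skip s : ev V Skip s 0 s
| ev_asg x e s : ok V s e -> ev V (Asg x e) s 1 (setv s x (eval s e))
| ev_sto a e1 e2 s : ok V s e1 -> ok V s e2 ->
    ev V (Sto a e1 e2) s 1 (seta s a (eval s e1) (eval s e2))
| ev_seq c1 c2 s t1 s1 t2 s2 : ev V c1 s t1 s1 -> ev V c2 s1 t2 s2 ->
    ev V (Seq c1 c2) s (t1 + t2) s2
| ev_ifT e c1 c2 s t s' : ok V s e -> eval s e <> 0 -> ev V c1 s t s' ->
    ev V (If e c1 c2) s t.+1 s'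
| ev_ifF e c1 c2 s t s' : ok V s e -> eval s e = 0 -> ev V c2 s t s' ->
    ev V (If e c1 c2) s t.+1 s'
| ev_whileF e c s : ok V s e -> eval s e = 0 -> ev V (While e c) s 1 s
| ev_whileT e c s t1 s1 t2 s2 : ok V s e -> eval s e <> 0 -> ev V c s t1 s1 ->
    ev V (While e c) s1 t2 s2 -> ev V (While e c) s (t1 + t2).+1 s2.

(* Cells 0-19 hold the program variables, 20-30 are temporaries, cell 31 holds
   the base address [b] of the arrays, and array [a < 16] is interleaved with
   the others: its [i]-th entry is cell [b + 16 * i + a]. *)
Definition tmp k := 20 + k.
Definition base_reg := 31.

(* Turns the index in temporary [k] into the address of that entry of array [a]. *)
Definition addr_code a k :=
  [:: Const (tmp k.+1) 16; Mul (tmp k) (tmp k) (tmp k.+1);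
      Const (tmp k.+1) a; Add (tmp k) (tmp k) (tmp k.+1);
      Add (tmp k) (tmp k) base_reg].

Fixpoint compE (e : expr) (k : nat) : seq instr :=
  match e with
  | EC v => [:: Const (tmp k) v]
  | EV x => [:: Const (tmp k) 0; Add (tmp k) x (tmp k)]
  | EA a e => compE e k ++ addr_code a k ++ [:: Ld (tmp k) (tmp k)]
  | EB o e1 e2 => compE e1 k ++ compE e2 k.+1 ++ [:: bop_instr o (tmp k) (tmp k) (tmp k.+1)]
  end.

(** Jump targets are absolute, so the compiler is told the address [pc] where its output will be
    placed. *)
Fixpoint compC (c : cmd) (pc : nat) : seq instr :=
  match c with
  | Skip => [::]
  | Asg x e => compE e 0 ++ [:: Const (tmp 1) 0; Add x (tmp 0) (tmp 1)]
  | Sto a e1 e2 =>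
      compE e1 0 ++ addr_code a 0 ++ compE e2 1 ++ [:: St (tmp 0) (tmp 1)]
  | Seq c1 c2 => let k1 := compC c1 pc in k1 ++ compC c2 (pc + size k1)
  | If e c1 c2 =>
      let ke := compE e 0 in
      let k1 := compC c1 (pc + size ke).+1 in
      let p2 := (pc + size ke + size k1).+2 in
      let k2 := compC c2 p2 in
      ke ++ Jz (tmp 0) p2 :: k1 ++ Jmp (p2 + size k2) :: k2
  | While e c =>
      let ke := compE e 0 in
      let kc := compC c (pc + size ke).+1 in
      ke ++ Jz (tmp 0) (pc + size ke + size kc).+2 :: kc ++ [:: Jmp pc]
  end.

(** Literals below 32 are below [V], and depths below 9 keep [tmp k.+1] clear of [base_reg]. *)
Fixpoint wfE (k : nat) (e : expr) : bool :=
  match e with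
  | EC v => (v < 32) && (k < 9)
  | EV x => (x < 20) && (k < 9)
  | EA a e => [&& a < 16, k < 9 & wfE k e]
  | EB _ e1 e2 => wfE k e1 && wfE k.+1 e2
  end.

Fixpoint wf (c : cmd) : bool :=
  match c with
  | Skip => true
  | Asg x e => (x < 20) && wfE 0 e
  | Sto a e1 e2 => [&& a < 16, wfE 0 e1 & wfE 1 e2]
  | Seq c1 c2 => wf c1 && wf c2
  | If e c1 c2 => [&& wfE 0 e, wf c1 & wf c2]
  | While e c => wfE 0 e && wf c
  end.

(** * Representation of states in memory and correctness of the compiler *)

Record rep (V b : nat) (s : state) (M : memory) : Prop := Rep {
  rep_var : forall x, x < 20 -> M x = vr s x;
  rep_base : M base_reg = b;
  rep_arr : forall a i, a < 16 -> M (b + 16 * i + a) = ar s a i;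
  rep_varV : forall x, x < 20 -> vr s x < V;
  rep_arrV : forall a i, a < 16 -> ar s a i < V }.

Lemma wfE_depth k e : wfE k e -> k < 9.
Proof.
elim: e k => [v|x|a e IH|o e1 IH1 e2 IH2] k /=; try by case/andP.
  by case/and3P.
by case/andP=> /IH1.
Qed.

Lemma eval_bound V b s M k e : 32 <= V -> rep V b s M -> wfE k e -> ok V s e -> eval s e < V.
Proof.
move=> hV hr; elim: e k => [v|x|a e IH|o e1 IH1 e2 IH2] k /=.
- by case/andP=> h _ _; lia.
- by case/andP=> h _ _; apply: rep_varV hr _ h.
- by case/and3P=> h _ _ _; apply: rep_arrV hr _ _ h.
- case/andP=> h1 h2 [o1 [o2]]; have := IH1 _ h1 o1; have := IH2 _ h2 o2.
  case: o => //= l2 l1 _; first lia.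
  + exact: leq_ltn_trans (leq_div _ _) l1.
  + by apply: leq_ltn_trans (leq_b1 _) _; lia.
Qed.

(** Code at depth [k] may clobber the temporaries from [tmp k] upwards only; this is why a left
    operand in [tmp k] survives the evaluation of the right one at depth [k.+1]. *)
Definition same_outside (k : nat) (M M' : memory) :=
  forall i, i < tmp k \/ base_reg <= i -> M' i = M i.

Lemma same_outside_trans k k' M M1 M2 : k <= k' ->
  same_outside k' M M1 -> same_outside k M1 M2 -> same_outside k M M2.
Proof. by rewrite /same_outside /tmp /base_reg => hk h1 h2 i hi; rewrite h2 ?h1 //; lia. Qed.

Lemma rep_same V b s k M M' : 32 <= b ->
  rep V b s M -> same_outside k M M' -> rep V b s M'.
Proof.
move=> hb [r1 r2 r3 r4 r5] h; split=> //.
- by move=> x hx; rewrite h ?r1 //; rewrite /tmp; lia.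
- by rewrite h ?r2 //; right.
- by move=> a i ha; rewrite h ?r3 // /base_reg; lia.
Qed.

Lemma upd_eq M a v : upd M a v a = v.
Proof. by rewrite /upd eqxx. Qed.

Lemma upd_neq M a v i : i <> a -> upd M a v i = M i.
Proof. by rewrite /upd => /eqP/negbTE ->. Qed.

Ltac upds := repeat (first [rewrite upd_eq | rewrite upd_neq; last lia]).

Lemma run_const B d v c M : v < B ->
  run_block B (Const d v :: c) M = run_block B c (upd M d v).
Proof. by move=> /= ->. Qed.

Lemma run_bop B o d x y c M : bop_eval o (M x) (M y) < B ->
  run_block B (bop_instr o d x y :: c) M =
  run_block B c (upd M d (bop_eval o (M x) (M y))).
Proof. by case: o => /= ->. Qed.

Lemma run_ld B d a c M : M (M a) < B ->
  run_block B (Ld d a :: c) M = run_block B c (upd M d (M (M a))).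
Proof. by move=> /= ->. Qed.

Lemma run_st B a x c M : M x < B ->
  run_block B (St a x :: c) M = run_block B c (upd M (M a) (M x)).
Proof. by move=> /= ->. Qed.

Section Compile.
Variables (B V b : nat).
Hypotheses (hV : 32 <= V) (hb : 32 <= b) (hB : 16 * V + b + 16 <= B).

Lemma run_addr a k M v : a < 16 -> k < 9 -> M base_reg = b -> M (tmp k) = v -> v < V ->
  exists M', [/\ run_block B (addr_code a k) M = Some M',
    M' (tmp k) = b + 16 * v + a & same_outside k M M'].
Proof.
rewrite /addr_code /tmp /base_reg => ha hk hbase hv hvV.
eexists; split.
- rewrite run_const; last lia.
  rewrite (run_bop (o := BMul)); last by rewrite /=; upds; lia.
  rewrite run_const; last lia.
  rewrite (run_bop (o := BAdd)); last by rewrite /=; upds; lia.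
  rewrite (run_bop (o := BAdd)); last by rewrite /=; upds; lia.
  by [].
- by rewrite /=; upds; lia.
- by move=> i; rewrite /tmp /base_reg => hi; upds.
Qed.

Lemma run_compE s M e k : rep V b s M -> wfE k e -> ok V s e ->
  exists M', [/\ run_block B (compE e k) M = Some M',
    M' (tmp k) = eval s e & same_outside k M M'].
Proof.
elim: e k M => [v|x|a e IH|o e1 IH1 e2 IH2] k M hr hw ho;
  have hk := wfE_depth hw.
- eexists; split.
  + by rewrite run_const //; move: hw => /=; lia.
  + by upds.
  + by move=> i; rewrite /tmp /base_reg => hi; upds.
- have /andP [hx _] := hw; have rx := rep_var hr hx; have vx := rep_varV hr hx.
  eexists; split.
  + rewrite run_const; last lia.
    rewrite (run_bop (o := BAdd)); last by rewrite /= /tmp; upds; lia.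
    by [].
  + by rewrite /= /tmp; upds; rewrite addn0.
  + by move=> i; rewrite /tmp /base_reg => hi; upds.
- have /and3P [ha _ hwe] := hw.
  have [M1 [r1 v1 s1]] := IH _ _ hr hwe ho.
  have hr1 := rep_same hb hr s1.
  have [M2 [r2 v2 s2]] := run_addr ha hk (rep_base hr1) v1 (eval_bound hV hr hwe ho).
  have hr2 := rep_same hb hr1 s2.
  eexists; split.
  + rewrite /= (run_block_cat _ r1) (run_block_cat _ r2) run_ld; first by [].
    rewrite v2 (rep_arr hr2) //; have := rep_arrV hr2 (eval s e) ha; lia.
  + by upds; rewrite v2 (rep_arr hr2).
  + apply: (same_outside_trans (leqnn k) s1); apply: (same_outside_trans _ s2) => //.
    by move=> i; rewrite /tmp /base_reg => hi; upds.
- have /andP [w1 w2] := hw; have [o1 [o2 o3]] := ho.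
  have [M1 [r1 v1 s1]] := IH1 _ _ hr w1 o1.
  have hr1 := rep_same hb hr s1.
  have [M2 [r2 v2 s2]] := IH2 _ _ hr1 w2 o2.
  have hk1 := wfE_depth w2.
  have {}v1 : M2 (tmp k) = eval s e1 by rewrite s2 // /tmp; lia.
  eexists; split.
  + rewrite /= (run_block_cat _ r1) (run_block_cat _ r2) run_bop; first by [].
    have := eval_bound hV hr hw ho; rewrite v1 v2 /=; lia.
  + by upds; rewrite v1 v2.
  + apply: (same_outside_trans (leqnn k) s1); apply: (same_outside_trans _ s2) => //.
    by move=> i; rewrite /tmp /base_reg => hi; upds.
Qed.

Lemma rep_setv s M M' x v : rep V b s M -> x < 20 -> v < V ->
  (forall i, i < 20 \/ base_reg <= i -> M' i = upd M x v i) -> rep V b (setv s x v) M'.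
Proof.
move=> [r1 r2 r3 r4 r5] hx hv h; split=> //.
- by move=> y hy; rewrite h /upd /=; [case: eqP => // _; exact: r1|left].
- by rewrite h ?upd_neq // /base_reg; lia.
- by move=> a i ha; rewrite h ?upd_neq ?r3 // /base_reg; lia.
- by move=> y hy /=; case: eqP => // _; apply: r4.
Qed.

Lemma rep_seta s M a i v : rep V b s M -> a < 16 -> v < V ->
  rep V b (seta s a i v) (upd M (b + 16 * i + a) v).
Proof.
move=> [r1 r2 r3 r4 r5] ha hv; split=> //=.
- by move=> y hy; rewrite upd_neq ?r1 //; lia.
- by rewrite upd_neq // /base_reg; lia.
- move=> a' j ha'; rewrite /upd -r3 //.
  (* Array numbers are below 16, the stride, so an address determines array and index. *)
  have -> // : (b + 16 * j + a' == b + 16 * i + a) = (a' == a) && (j == i).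
  by apply/eqP/andP => [?|[/eqP-> /eqP->] //]; split; apply/eqP; lia.
- by move=> a' j ha'; case: ifP => // _; apply: r5.
Qed.

(** [K] is any bound on the code size rather than the size itself, so that the induction can use one
    common factor for all subcommands. *)
Lemma compC_steps P c s t s' : ev V c s t s' -> forall pc M, wf c -> rep V b s M ->
  code_at P pc (compC c pc) -> forall K, size (compC c pc) <= K ->
  exists k M', [/\ steps B P k (pc, M) (pc + size (compC c pc), M'),
    rep V b s' M' & k <= K * t].
Proof.
elim=> {c s t s'}.
- move=> s pc M _ hr _ K _; exists 0, M; split=> //=.
  by rewrite addn0; apply: steps_refl.
- move=> x e s ho pc M /= /andP [hx hw] hr hc K hK.
  have [M1 [r1 v1 s1]] := run_compE hr hw ho; have hr1 := rep_same hb hr s1.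
  have hv := eval_bound hV hr hw ho.
  set code := _ ++ _ in hc hK *.
  have hrun : run_block B code M = Some (upd (upd M1 (tmp 1) 0) x (eval s e)).
    rewrite (run_block_cat _ r1) run_const; last lia.
    rewrite /tmp in v1 *; rewrite (run_bop (o := BAdd)); last by rewrite /=; upds; lia.
    by rewrite /=; upds; rewrite v1 addn0.
  exists (size code), (upd (upd M1 (tmp 1) 0) x (eval s e)); split.
  + exact: run_block_steps hc hrun.
  + apply: rep_setv hr1 hx hv _ => i; rewrite /base_reg => hi.
    by rewrite /upd; case: (i == x) => //; rewrite ifF // /tmp; lia.
  + by rewrite muln1.
- move=> a e1 e2 s o1 o2 pc M /= /and3P [ha w1 w2] hr hc K hK.
  have [M1 [r1 v1 s1]] := run_compE hr w1 o1; have hr1 := rep_same hb hr s1.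
  have h1 := eval_bound hV hr w1 o1; have h2 := eval_bound hV hr w2 o2.
  have [M2 [r2 v2 s2]] := run_addr ha (wfE_depth w1) (rep_base hr1) v1 h1.
  have hr2 := rep_same hb hr1 s2.
  have [M3 [r3 v3 s3]] := run_compE hr2 w2 o2; have hr3 := rep_same hb hr2 s3.
  set code := _ ++ _ in hc hK *.
  have hrun : run_block B code M = Some (upd M3 (b + 16 * eval s e1 + a) (eval s e2)).
    rewrite (run_block_cat _ r1) (run_block_cat _ r2) (run_block_cat _ r3).
    rewrite run_st; last by rewrite v3; lia.
    by rewrite s3 ?v2 ?v3 //; left.
  exists (size code); eexists; split.
  + exact: run_block_steps hc hrun.
  + exact: rep_seta.
  + by rewrite muln1.
- move=> c1 c2 s t1 s1 t2 s2 _ IH1 _ IH2 pc M /= /andP [w1 w2] hr.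
  move=> /code_at_cat [h1 h2] K; rewrite size_cat => hK.
  have [|k1 [M1 [st1 hr1 l1]]] := IH1 _ _ w1 hr h1 K; first lia.
  have [|k2 [M2 [st2 hr2 l2]]] := IH2 _ _ w2 hr1 h2 K; first lia.
  exists (k1 + k2), M2; split=> //; last by rewrite mulnDr leq_add.
  by rewrite addnA; apply: steps_trans st1 st2.
- move=> e c1 c2 s t s' ho hne _ IH pc M /= /and3P [w w1 w2] hr.
  have [M1 [r1 v1 s1]] := run_compE hr w ho; have hr1 := rep_same hb hr s1.
  move=> /code_at_cat [he] /code_at_cons [hj] /code_at_cat [h1].
  rewrite -[_.+1 + size _]/((pc + _ + _).+1) => /code_at_cons [hjmp _] K.
  rewrite size_cat /= size_cat /= => hK.
  have st1 := run_block_steps he r1.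
  have [|k [M2 [st2 hr2 l2]]] := IH _ _ w1 hr1 h1 K; first lia.
  exists (size (compE e 0) + k.+2), M2; split=> //; last by rewrite mulnS; lia.
  apply: steps_trans st1 _; apply: (steps_step (c1 := ((pc + size (compE e 0)).+1, M1))).
  + by rewrite hj.
  + by rewrite hj /= v1; case: eqP.
  rewrite -addn1; apply: steps_trans st2 _.
  apply: steps_step (steps_refl _ _ _); rewrite hjmp //=.
  by congr (Some (_, _)); lia.
- move=> e c1 c2 s t s' ho h0 _ IH pc M /= /and3P [w w1 w2] hr.
  have [M1 [r1 v1 s1]] := run_compE hr w ho; have hr1 := rep_same hb hr s1.
  move=> /code_at_cat [he] /code_at_cons [hj] /code_at_cat [_].
  rewrite -[_.+1 + size _]/((pc + _ + _).+1) => /code_at_cons [_ h2] K.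
  rewrite size_cat /= size_cat /= => hK.
  have st1 := run_block_steps he r1.
  have [|k [M2 [st2 hr2 l2]]] := IH _ _ w2 hr1 h2 K; first lia.
  exists (size (compE e 0) + k.+1), M2; split=> //; last by rewrite mulnS; lia.
  apply: steps_trans st1 _; apply: steps_step.
  + by rewrite hj.
  + by rewrite hj /= v1 h0 eqxx.
  move: st2; congr (steps _ _ _ (_, _) (_, _)); lia.
- move=> e c s ho h0 pc M /= /andP [w w1] hr.
  have [M1 [r1 v1 s1]] := run_compE hr w ho; have hr1 := rep_same hb hr s1.
  move=> /code_at_cat [he] /code_at_cons [hj] _ K.
  rewrite size_cat /= size_cat /= => hK.
  exists (size (compE e 0) + 1), M1; split=> //; last lia.
  apply: steps_trans (run_block_steps he r1) _.
  apply: steps_step (steps_refl _ _ _); rewrite hj //= v1 h0 eqxx.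
  by congr (Some (_, _)); lia.
- move=> e c s t1 s1 t2 s2 ho hne _ IH1 _ IH2 pc M /= /andP [w w1] hr hall K hK.
  have [M1 [r1 v1 sm1]] := run_compE hr w ho; have hr1 := rep_same hb hr sm1.
  move: (hall) => /code_at_cat [he] /code_at_cons [hj] /code_at_cat [h1].
  rewrite -[_.+1 + size _]/((pc + _ + _).+1) => /code_at_cons [hjmp _].
  have hK' := hK; rewrite size_cat /= size_cat /= in hK'.
  have [|k1 [M2 [st1 hr2 l1]]] := IH1 _ _ w1 hr1 h1 K; first lia.
  have [|k2 [M3 [st2 hr3 l2]]] := IH2 pc M2 _ hr2 hall K hK; first exact/andP.
  exists (size (compE e 0) + (k1.+1 + k2.+1)), M3; split=> //; last first.
    by rewrite mulnS mulnDr; lia.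
  apply: steps_trans (run_block_steps he r1) _.
  apply: (steps_trans (c2 := ((pc + size (compE e 0) + size (compC c (pc + size (compE e 0)).+1)).+1, M2))).
  + apply: steps_step st1; rewrite hj // /= v1; by case: eqP.
  + by apply: steps_step st2; rewrite hjmp.
Qed.

End Compile.

(** * Relocating the input *)

(* The input occupies the cells [1 .. 3n], hence the cells wanted as registers,
   and at first only cell 0 may be overwritten.  Doubling it makes it an address
   beyond the input, through which cells 1-31 are saved straight to their place
   in array 0; the remaining input cells are then copied by a loop. *)
Definition save_cells (m i0 : nat) : seq instr :=
  flatten [seq [:: Add 0 0 1; St 0 i] | i <- iota i0 m].

(** Nine doublings turn [n] into the base address [512 * n]. After 31 saved cells with stride 16,
    cell 0 has moved on by [480 = 16 * 30]; subtracting this gives the base, and dividing the base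
    by 512 gives back [n], whence the last input cell [3 * n]. *)
Definition boot_head : seq instr :=
  nseq 9 (Add 0 0 0) ++ [:: St 0 1; Const 1 16] ++ save_cells 30 2 ++
  [:: Const 2 480; Defs.Sub 31 0 2; Const 3 512; Div 4 31 3; Const 5 3; Mul 4 4 5;
      Const 6 1; Const 7 31].

Definition boot_loop : seq instr :=
  [:: Lt 8 7 4; Jz 8 87; Add 0 0 1; Add 7 7 6; Ld 8 7; St 0 8; Jmp 80].

Definition boot_tail : seq instr := [:: Const 3 512; Div 0 31 3].

(** For [n = 0] doubling would yield the base 0, so the first jump leaves the program at once, with
    the optimum 0 already in cell 0. The head has 79 instructions, hence the addresses 80, 87 and 89
    of loop, tail and compiled code. *)
Definition program (c : cmd) : seq instr :=
  let code := boot_head ++ boot_loop ++ boot_tail ++ compC c 89 in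
  Jz 0 (size code).+1 :: code.

Lemma run_save V m i0 q M : 2 <= i0 -> i0 + m <= 32 -> 32 <= q -> q + 16 * m < V ->
  M 0 = q -> M 1 = 16 -> (forall x, M x < V) ->
  exists M', [/\ run_block V (save_cells m i0) M = Some M', M' 0 = q + 16 * m,
    forall j, j < m -> M' (q + 16 * j.+1) = M (i0 + j) &
    forall x, 0 < x -> (forall j, j < m -> x <> q + 16 * j.+1) -> M' x = M x].
Proof.
elim: m i0 q M => [|m IH] i0 q M h2 h32 hq hqV h0 h1 hV.
  by exists M; split=> //; rewrite h0; lia.
have [||||||x|M' [r v0 vj vx]] := IH i0.+1 (q + 16) (upd (upd M 0 (q + 16)) (q + 16) (M i0)).
- lia.
- lia.
- lia.
- lia.
- by upds.
- by upds.
- by rewrite /upd; case: eqP => // _; case: eqP => // _; lia.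
exists M'; split.
- rewrite /save_cells /= -/(save_cells _ _).
  rewrite h0 h1 ifT ?upd_eq; last lia.
  by upds; rewrite hV.
- by rewrite v0; lia.
- case=> [|j] hj.
    by rewrite muln1 vx ?upd_eq ?addn0 //; lia.
  have -> : q + 16 * j.+2 = q + 16 + 16 * j.+1 by lia.
  by rewrite vj ?addSnnS; [upds|lia].
- move=> x hx hxj; have := hxj 0 isT => hx0.
  rewrite vx //; first by upds.
  by move=> j hj; have := hxj j.+1; lia.
Qed.

Section Boot.
Variables (J : seq job) (V : nat).
Local Notation n := (size J).
Local Notation b := (512 * n).
Hypotheses (hn : 0 < n) (hV : 1024 * n + 1024 <= V) (hinit : forall x, init_mem J x < V).

Lemma init_mem_beyond x : 3 * n < x -> init_mem J x = 0.
Proof. by move=> hx; rewrite /init_mem ifF ?ifF //; lia. Qed.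

Lemma init_mem0 : init_mem J 0 = n. Proof. by []. Qed.

(** Entry [j] of array 0 is input cell [j.+1], because cell 0 holds [n]; cell 7 is the last input
    cell copied. *)
Definition loop_inv i (M : memory) :=
  [/\ M 31 = b, M 4 = 3 * n, M 6 = 1, M 7 = i.+1 & M 0 = b + 16 * i] /\
  [/\ M 1 = 16, forall j, j <= i -> M (b + 16 * j) = init_mem J j.+1 &
      forall x, 32 <= x -> (forall j, j <= i -> x <> b + 16 * j) -> M x = init_mem J x].

Lemma run_double k M : 2 ^ k * M 0 < V -> exists M',
  [/\ run_block V (nseq k (Add 0 0 0)) M = Some M', M' 0 = 2 ^ k * M 0 &
    forall x, 0 < x -> M' x = M x].
Proof.
elim: k M => [|k IH] M hk; first by exists M; split=> //; rewrite mul1n.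
have [|M' [r v0 vx]] := IH (upd M 0 (M 0 + M 0)).
  by rewrite upd_eq addnn -mul2n mulnA -expnSr.
exists M'; split.
- rewrite /= ifT //; apply: leq_ltn_trans hk; rewrite addnn -mul2n leq_mul //.
  by rewrite expnS leq_pmulr ?expn_gt0.
- by rewrite v0 upd_eq addnn -mul2n mulnA -expnSr.
- by move=> x hx; rewrite vx //; upds.
Qed.

Lemma run_block_bounded c M M' : (forall x, M x < V) -> run_block V c M = Some M' ->
  forall x, M' x < V.
Proof.
elim: c M => [|i c IH] M hM /=; first by case=> <-.
case: straight => //; case st: step => [[q M1]|] //; apply: IH.
exact: step_bounded hM st.
Qed.

Lemma boot_head_spec : exists M, run_block V boot_head (init_mem J) = Some M /\ loop_inv 30 M.
Proof.
have [|M1 [r1 v1 x1]] := @run_double 9 (init_mem J).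
  by rewrite init_mem0 -[2 ^ 9]/512; lia.
rewrite init_mem0 -[2 ^ 9]/512 in v1.
have b1 := run_block_bounded hinit r1.
pose M2 := upd (upd M1 b (M1 1)) 1 16.
have r2 : run_block V [:: St 0 1; Const 1 16] M1 = Some M2.
  rewrite run_st ?b1 // run_const; last lia.
  by rewrite v1.
have b2 := run_block_bounded b1 r2.
have [|||||||M3 [r3 v3 y3 x3]] := @run_save V 30 2 b M2; try by lia.
- by rewrite /M2; upds.
- by rewrite /M2; upds.
- exact: b2.
have q3 x : 0 < x -> (forall j, j < 30 -> x <> b + 16 * j.+1) -> x <> b -> x <> 1 ->
    M3 x = init_mem J x.
  by move=> h0 hj hb h1; rewrite x3 // /M2; upds; rewrite x1.
have M31 : M3 1 = 16 by rewrite x3 // => j; lia.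
eexists; split.
  rewrite /boot_head (run_block_cat _ r1) (run_block_cat _ r2) (run_block_cat _ r3).
  rewrite run_const; last lia.
  rewrite (run_bop (o := BSub)); last by rewrite /=; upds; lia.
  rewrite run_const; last lia.
  rewrite (run_bop (o := BDiv)); last first.
    by rewrite /=; upds; apply: leq_ltn_trans (leq_div _ _) _; lia.
  rewrite run_const; last lia.
  rewrite (run_bop (o := BMul)); last first.
    by rewrite /=; upds; rewrite v3; lia.
  rewrite run_const; last lia.
  rewrite run_const; last lia.
  by [].
rewrite /bop_eval; split; split.
- by upds; rewrite v3; lia.
- by upds; rewrite v3; lia.
- by upds.
- by upds.
- by upds; rewrite v3.
- by upds.
- move=> j hj; upds; case: j hj => [|j] hj.
    rewrite muln0 addn0 x3; [|lia|move=> j; lia].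
    by rewrite /M2; upds; rewrite x1.
  rewrite y3; last lia.
  by rewrite /M2; upds; rewrite x1 //; congr (init_mem J _); lia.
- move=> x hx hxj; upds; rewrite q3 //; try lia.
  + by move=> j hj; apply: hxj; lia.
  + by have := hxj 0; lia.
Qed.

Lemma boot_loop_spec P : code_at P 80 boot_loop -> forall i M, loop_inv i M -> 30 <= i ->
  (forall x, M x < V) -> exists k M', [/\ steps V P k (80, M) (87, M'),
    exists i', [/\ loop_inv i' M', 30 <= i' & 3 * n <= i'.+1] & k <= 7 * (3 * n - i) + 2].
Proof.
rewrite (_ : boot_loop = [:: Lt 8 7 4] ++ Jz 8 87 ::
  [:: Add 0 0 1; Add 7 7 6; Ld 8 7; St 0 8] ++ [:: Jmp 80]) //.
move=> /code_at_cat [c1 /code_at_cons [j1 /code_at_cat [c2 /code_at_cons [j2 _]]]] i M.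
move Em: (3 * n - i) => m; elim: m i M Em => [|m IH] i M Em hinv h30 hM;
  have [[v31 v4 v6 v7 v0] [v1 va vx]] := hinv;
  have r1 : run_block V [:: Lt 8 7 4] M = Some (upd M 8 (M 7 < M 4)) by
    rewrite (run_bop (o := BLt)) //=; apply: leq_ltn_trans (leq_b1 _) _; lia.
all: have st1 := run_block_steps c1 r1.
all: have hexit : M 4 <= M 7 -> exists k M', [/\ steps V P k (80, M) (87, M'),
    exists i', [/\ loop_inv i' M', 30 <= i' & 3 * n <= i'.+1] & k <= 2].
1,3: move=> hge; exists (1 + 1), (upd M 8 (M 7 < M 4)); split=> //.
1,3: by apply: steps_trans st1 _; apply: steps_step (steps_refl _ _ _);
  [rewrite j1|rewrite j1 /= upd_eq ltnNge hge].
1,2: by exists i; split=> //; [split; split; upds => //|lia];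
  [move=> j hj; upds; apply: va|move=> x h1 h2; upds; apply: vx].
  have [|k [M' [h1 h2 h3]]] := hexit; first lia.
  by exists k, M'; split=> //; lia.
have [/hexit [k [M' [h1 h2 h3]]]|hlt] := leqP (M 4) (M 7).
  by exists k, M'; split=> //; lia.
pose M1 := upd M 8 (M 7 < M 4); have b1 := run_block_bounded hM r1.
pose M' := upd (upd (upd (upd M1 0 (b + 16 * i.+1)) 7 i.+2) 8 (init_mem J i.+2))
  (b + 16 * i.+1) (init_mem J i.+2).
have r2 : run_block V [:: Add 0 0 1; Add 7 7 6; Ld 8 7; St 0 8] M1 = Some M'.
  have e0 : M1 0 + M1 1 = b + 16 * i.+1 by rewrite /M1; upds; rewrite v0 v1; lia.
  have e7 : M1 7 + M1 6 = i.+2 by rewrite /M1; upds; rewrite v7 v6 addn1.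
  have e8 : M1 i.+2 = init_mem J i.+2 by rewrite /M1; upds; apply: vx => // j hj; lia.
  rewrite (run_bop (o := BAdd)) /bop_eval e0; last lia.
  rewrite (run_bop (o := BAdd)) /bop_eval; upds; rewrite e7; last lia.
  rewrite run_ld; upds; rewrite e8; last exact: hinit.
  by rewrite run_st; upds.
have st2 := run_block_steps c2 r2; have b2 := run_block_bounded b1 r2.
have [|||k [M3 [st3 hi3 l3]]] := IH i.+1 M' _ _ _ b2; try lia.
  split; split; rewrite /M' /M1; upds => //.
  - move=> j hj; have [<-|ne] := eqVneq i.+1 j; first by upds.
    by rewrite upd_neq; [upds; apply: va|]; lia.
  - move=> x h32 hx; have := hx i.+1 (leqnn _) => hx1; upds.
    by apply: vx => // j hj; apply: hx; lia.
exists (1 + ((1 + 4) + 1 + k)), M3; split=> //; last lia.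
apply: steps_trans st1 _; rewrite -!addnA add1n.
apply: (steps_step (c1 := (82, M1))); [by rewrite j1|by rewrite j1 /= /M1 upd_eq hlt|].
apply: steps_trans st2 _; rewrite add1n.
by apply: steps_step st3; rewrite j2.
Qed.

Lemma boot_spec c : exists k M b0, [/\
  steps V (program c) k (0, init_mem J) (89, M), k <= 100 * n + 400, (forall x, M x < V),
  rep V b0 (State M (fun a i => if a == 0 then init_mem J i.+1 else 0)) M & b0 = b /\ M 0 = n].
Proof.
have [M1 [r1 h1]] := boot_head_spec; have b1 := run_block_bounded hinit r1.
have : code_at (program c) 0 (program c) by move=> i; rewrite add0n.
rewrite {2}/program => /code_at_cons [j0] /code_at_cat [c1] /code_at_cat [c2] /code_at_cat [c3 _].
have [k [M2 [st2 [i [[[v31 v4 v6 v7 v0] [v1 va vx]] h30 hi3]] l2]]] := boot_loop_spec c2 h1 isT b1.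
have st1 := run_block_steps c1 r1.
have b2 := steps_bounded st2 b1.
pose M := upd (upd M2 3 512) 0 n.
have r3 : run_block V boot_tail M2 = Some M.
  rewrite run_const; last lia.
  have e : bop_eval BDiv (upd M2 3 512 31) (upd M2 3 512 3) = n.
    by upds; rewrite v31 /= mulnC mulnK.
  by rewrite (run_bop (o := BDiv)) e //; lia.
have b3 := run_block_bounded b2 r3; have st3 := run_block_steps c3 r3.
exists (1 + (79 + (k + 2))), M, b; split=> //.
- rewrite add1n; apply: (steps_step (c1 := (1, init_mem J))).
  + by rewrite j0.
  + by rewrite j0 /= init_mem0 ifF //; lia.
  apply: steps_trans st1 _; apply: steps_trans st2 _; exact: st3.
- by lia.
- split=> //.
  (* Entries that were never written lie beyond the input and are therefore 0: all arrays but array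
     0 start empty at no cost. *)
  + move=> a x ha /=; rewrite /M; upds; case: (posnP a) => [->|ha0].
      rewrite addn0; have [hx|hx] := leqP x i; first by rewrite va.
      by rewrite vx ?init_mem_beyond //; lia.
    by rewrite vx ?init_mem_beyond ?ifF //; lia.
  + by move=> a x _ /=; case: eqP => // _; lia.
Qed.
End Boot.

(** [B] exceeds every address [512 * n + 16 * i + a] with [i < V] and [a < 16]. The summand 400 in
    the fuel pays for the relocation. *)
Lemma program_run c J V B : wf c -> 0 < size J -> 1024 * size J + 1024 <= V ->
  (forall x, init_mem J x < V) -> 16 * V + 512 * size J + 16 <= B ->
  forall T (R : nat -> Prop), (forall s, vr s 0 = size J -> (forall i, ar s 0 i = init_mem J i.+1) ->
    (forall a i, 0 < a -> ar s a i = 0) ->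
    (forall x, x < 20 -> vr s x < V) ->
    exists t s', [/\ ev V c s t s', t <= T & R (vr s' 0)]) ->
  forall fuel, (size (compC c 89) + 400) * (size J + T + 1) <= fuel ->
  exists M', run B (program c) fuel 0 (init_mem J) = Some M' /\ R (M' 0).
Proof.
move=> hwf hn hV hinit hB T R hc fuel hf.
have [k [M [b0 [st1 hk hM hrep [eb hM0]]]]] := boot_spec hn hV hinit c.
rewrite {}eb in hrep.
have [|||t [s' [hev ht hR]]] := hc _ _ _ _ (rep_varV hrep) => //.
  by move=> a i; case: a.
have : code_at (program c) 0 (program c) by move=> i; rewrite add0n.
rewrite {2}/program => /code_at_cons [_] /code_at_cat [_] /code_at_cat [_] /code_at_cat [_ c4].
have {}c4 : code_at (program c) 89 (compC c 89) by exact: c4.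
have [|||k2 [M2 [st2 hrep2 l2]]] :=
  compC_steps (B := B) _ _ _ hev hwf hrep c4 (leqnn _); try lia.
exists M2; split; last by rewrite (rep_var hrep2).
have st1' := steps_mono (_ : V <= B) st1.
have st := steps_trans (st1' _) st2.
apply: (run_steps (st _)); first lia.
  by apply: nth_default.
have : size (compC c 89) * t <= size (compC c 89) * T by rewrite leq_mul2l ht orbT.
by rewrite !mulnDl !mulnDr in hf; lia.
Qed.

(** * Feasible sets of jobs *)

Fixpoint early (t : nat) (s : seq job) : bool :=
  if s is j :: s' then (t + jp j <= jd j) && early (t + jp j) s' else true.

Definition psum (s : seq job) := \sum_(j <- s) jp j.
Definition wsum (s : seq job) := \sum_(j <- s) jw j.

(** Being independent of order, this condition passes to subsets and survives the exchange of jobs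
    with equal [p] and [d]. Its sufficiency comes out of the recursion: [dp_opt] bounds every such
    set, and [dp_sound] realises the bound by an early sequence. *)
Definition load (s : seq job) := forall x, \sum_(j <- s | jd j <= x) jp j <= x.

Lemma early_le t t' s : t' <= t -> early t s -> early t' s.
Proof.
elim: s t t' => //= j s IH t t' le /andP [h1 h2]; apply/andP; split; first lia.
by apply: IH h2; lia.
Qed.

Lemma early_cat t s1 s2 : early t (s1 ++ s2) = early t s1 && early (t + psum s1) s2.
Proof.
elim: s1 t => [|j s IH] t /=; first by rewrite /psum big_nil addn0.
by rewrite IH -andbA /psum big_cons addnA.
Qed.

(** When the last job due by [x] completes, at time at most [x], all jobs due by [x] are done. If
    there is no such job, [t] itself may exceed [x]. *)
Lemma early_load_from t s x : early t s -> has (fun j => jd j <= x) s ->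
  t + \sum_(j <- s | jd j <= x) jp j <= x.
Proof.
elim: s t => //= j s IH t /andP [h1 h2] hs; rewrite big_cons.
have [hs'|] := boolP (has (fun j => jd j <= x) s).
  by have := IH _ h2 hs'; case: ifP => _; lia.
move=> hn; rewrite (negbTE hn) orbF in hs; rewrite hs big1_seq ?addn0; first lia.
by move=> i /andP [h3 /(hasPn hn)]; rewrite h3.
Qed.

Lemma early_load s : early 0 s -> load s.
Proof.
move=> he x; have [/(early_load_from he) //|] := boolP (has (fun j => jd j <= x) s).
by move/hasPn => h; rewrite big1_seq // => j /andP [h1 /h]; rewrite h1.
Qed.

Lemma load_perm s s' : perm_eq s s' -> load s -> load s'.
Proof. by move=> h l x; rewrite -(perm_big _ h). Qed.

Lemma load_subseq s s' : subseq s s' -> load s' -> load s.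
Proof.
move=> h l x; apply: leq_trans (l x); elim: s' s h {l} => [|j s' IH] [|i s] //= h.
- by rewrite big_nil.
- move: h; case: eqP => [->|_] /IH h; rewrite !big_cons; last first.
    by move: h; rewrite big_cons; case: (jd j <= x); case: (jd i <= x); lia.
  by case: ifP; lia.
Qed.

Lemma psum_load s x : load s -> (forall j, j \in s -> jd j <= x) -> psum s <= x.
Proof.
move=> /(_ x) h hx; rewrite /psum big_seq; apply: leq_trans h.
by rewrite [leqRHS]big_seq_cond big_seq_cond leq_eqVlt; apply/orP; left; apply/eqP;
  apply: eq_bigl => j /=; have := hx j; case: (j \in s) => //= ->.
Qed.

(* Lawler-Moore recursion; the head of the list is the job with the latest due
   date.  [dp K t] is the largest weight of a subset of [K] that can be completed
   in time with total processing time at most [t]. *)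
Fixpoint dp (K : seq job) (t : nat) : nat :=
  if K is j :: K' then
    if jp j <= t then maxn (dp K' t) (dp K' (minn t (jd j) - jp j) + jw j) else dp K' t
  else 0.

Lemma dp_wsum K t : dp K t <= wsum K.
Proof.
rewrite /wsum; elim: K t => [|j K IH] t /=; first by [].
rewrite big_cons; have := IH t; have := IH (minn t (jd j) - jp j).
by case: ifP; lia.
Qed.

(** The head is scheduled last: the jobs chosen before it take at most [min(t, d) - p], so it ends
    by [min(t, d)]. The hypothesis [p <= d] prevents this subtraction from truncating. *)
Lemma dp_sound K t : all (fun j => jp j <= jd j) K ->
  exists E, [/\ subseq E K, early 0 (rev E), psum E <= t & wsum E = dp K t].
Proof.
elim: K t => [|j K IH] t /=.
  by move=> _; exists [::]; rewrite /psum /wsum !big_nil.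
case/andP=> hj hK; have [E [h1 h2 h3 h4]] := IH t hK.
have skip : exists E0, [/\ subseq E0 (j :: K), early 0 (rev E0), psum E0 <= t & wsum E0 = dp K t].
  by exists E; split=> //; apply: subseq_trans h1 (subseq_cons _ _).
case: ifP => // ht.
have [E' [e1 e2 e3 e4]] := IH (minn t (jd j) - jp j) hK.
case: (leqP (dp K (minn t (jd j) - jp j) + jw j) (dp K t)) => hm //.
exists (j :: E'); split=> /=.
- by rewrite eqxx.
- rewrite rev_cons -cats1 early_cat e2 /= andbT add0n.
  have -> : psum (rev E') = psum E' by apply: perm_big; rewrite perm_rev.
  by lia.
- by rewrite /psum big_cons; move: e3; rewrite /psum; lia.
- by rewrite /wsum big_cons -e4 addnC.
Qed.

(** If [E] contains the head, then all of [E] is due by the head's date [d], so its total length is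
    at most [d] as well as [t]. *)
Lemma dp_opt K t E : sorted (fun i j => jd j <= jd i) K -> subseq E K -> load E ->
  psum E <= t -> wsum E <= dp K t.
Proof.
elim: K t E => [|j K IH] t [|i E] //=; try by rewrite /wsum big_nil.
move=> hs; have hsK := path_sorted hs.
case: eqP => [->|_] hE hl hp; last first.
  by have := IH t _ hsK hE hl hp; case: ifP; lia.
have hd : psum (j :: E) <= jd j.
  apply: psum_load hl _ => k; rewrite inE => /orP [/eqP -> //|/(mem_subseq hE) hk].
  have := hs; rewrite path_sortedE; last by move=> ? ? ? h1 h2; apply: leq_trans h2 h1.
  by case/andP=> /allP /(_ _ hk).
move: hp hd; rewrite /wsum /psum !big_cons => hp hd.
rewrite ifT; last lia.
rewrite addnC leq_max leq_add2r; apply/orP; right; apply: IH => //.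
- by apply: load_subseq hl; rewrite subseq_cons.
- by rewrite /psum; lia.
Qed.

(** Deleting a tardy job only moves later jobs forward, so the early jobs remain early by
    themselves. *)
Lemma tardy_early_part t s : exists E R, [/\ perm_eq s (E ++ R), early t E &
  tardy_weight_from t s = wsum R].
Proof.
elim: s t => [|j s IH] t /=; first by exists [::], [::]; rewrite /wsum big_nil.
have [E [R [h1 h2 h3]]] := IH (t + jp j).
case: leqP => hj.
  by exists (j :: E), R; rewrite /= perm_cons hj h2 h1 h3.
exists E, (j :: R); split.
- by rewrite perm_sym perm_catC /= perm_cons perm_catC perm_sym.
- by apply: early_le h2; rewrite leq_addr.
- by rewrite /wsum big_cons h3.
Qed.

Lemma tardy_early t E R : early t E -> tardy_weight_from t (E ++ R) <= wsum R.
Proof.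
rewrite /wsum; elim: E t => [|j E IH] t /=; last first.
  by case/andP=> hj /IH h; rewrite ifF //; lia.
move=> _; elim: R t => [|j R IH] t; first by rewrite big_nil.
by rewrite /= big_cons; have := IH (t + jp j); case: ifP; lia.
Qed.

(** Optimality is tested against [load] instead of [early], so that competitors can be treated as
    sets. *)
Lemma is_opt_early J m E R : perm_eq J (E ++ R) -> early 0 E -> wsum E = m ->
  (forall E' R', perm_eq J (E' ++ R') -> load E' -> wsum E' <= m) ->
  is_opt J (wsum J - m).
Proof.
move=> hp he hm hub.
have wJ E0 R0 : perm_eq J (E0 ++ R0) -> wsum J = wsum E0 + wsum R0.
  by move=> h; rewrite /wsum (perm_big _ h) big_cat.
have lb s : is_schedule J s -> wsum J - m <= tardy_weight s.
  rewrite /is_schedule perm_sym => hs.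
  have [E' [R' [h1 h2 h3]]] := tardy_early_part 0 s.
  have h := perm_trans hs h1; rewrite (wJ _ _ h) /tardy_weight h3.
  by have := hub _ _ h (early_load h2); lia.
split=> //; exists (E ++ R); rewrite /is_schedule perm_sym; split=> //.
apply/eqP; rewrite eqn_leq lb ?andbT; last by rewrite /is_schedule perm_sym.
by rewrite (wJ _ _ hp) hm addKn; apply: tardy_early.
Qed.

(** * Thinning the classes of jobs with equal processing time and due date *)

Section Keep.
Variable J : seq job.
Local Notation n := (size J).
(** Jobs become indices because [J] may contain equal triples, while the exchange argument needs
    duplicate-free sets. *)
Definition nj i := nth (0, 0, 0) J i.
Local Notation p i := (jp (nj i)).
Local Notation w i := (jw (nj i)).
Local Notation d i := (jd (nj i)).

Definition cls i k := (p k == p i) && (d k == d i).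

(* Only [d %/ p] jobs with the same [p] and [d] fit before [d]; [x %/ 0 = 0]
   discards the jobs with [p = 0], which are always early. *)
Fixpoint keep (X : seq nat) : seq nat :=
  if X is j :: X' then
    if count (cls j) (keep X') < d j %/ p j then j :: keep X' else keep X'
  else [::].

Lemma keep_subseq X : subseq (keep X) X.
Proof.
elim: X => //= j X IH; case: ifP => _; first by rewrite /= eqxx.
exact: subseq_trans IH (subseq_cons _ _).
Qed.

Lemma cls_eq i j : cls i j -> cls i =1 cls j.
Proof. by case/andP=> /eqP h1 /eqP h2 k; rewrite /cls h1 h2. Qed.

Lemma keep_count i X : count (cls i) (keep X) <= d i %/ p i.
Proof.
elim: X => //= j X IH; case: ifP => // hj /=; case hc: (cls i j) => //=.
by rewrite add1n (eq_count (cls_eq hc)); case/andP: hc => /eqP <- /eqP <-.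
Qed.

Lemma keep_pos j X : j \in keep X -> 0 < p j <= d j.
Proof.
elim: X => //= i X IH; case: ifP => // hi; rewrite inE => /orP [/eqP ->|//].
have : 0 < d i %/ p i by lia.
by case: (p i) => [|q]; rewrite ?divn0 // divn_gt0.
Qed.

(** The list is treated from its tail, heaviest job first. A job is refused only if [d %/ p] members
    of its class, all from the tail and thus at least as heavy, are kept already. *)
Lemma keep_full X : pairwise (fun j k => w j <= w k) X ->
  forall i, i \in X -> i \notin keep X ->
  d i %/ p i <= count (fun k => cls i k && (w i <= w k)) (keep X).
Proof.
elim: X => //= j X IH /andP [hj hX] i; case: ifP => hc; rewrite inE.
  rewrite inE negb_or => /orP [/eqP ->|hi] /andP [hne hn]; first by rewrite eqxx in hne.
  by apply: leq_trans (IH hX i hi hn) _; rewrite /= leq_addl.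
case/orP=> [/eqP -> _|]; last exact: IH.
rewrite (@eq_in_count _ _ (cls j)); first by rewrite leqNgt hc.
move=> k /(mem_subseq (keep_subseq X)) hk /=.
by rewrite (allP hj) ?andbT.
Qed.

Lemma count_partition (T : Type) (P : pred T) (f : T -> nat) m (s : seq T) :
  (forall x, P x -> f x < m) -> count P s = \sum_(q < m) count (fun x => P x && (f x == q)) s.
Proof.
move=> hf; elim: s => [|x s IH] /=; first by rewrite big1.
rewrite big_split /= -IH; congr (_ + _); case hx: (P x); last by rewrite big1.
rewrite (bigD1 (Ordinal (hf x hx))) //= eqxx big1 // => i /eqP hi.
by case: eqP => // h; case: hi; apply: val_inj.
Qed.

(** Kept jobs due at [x] have [p <= x]; those with [p = q] form one class, of size at most
    [x %/ q]. *)
Lemma keep_row x X : count (fun j => d j == x) (keep X) <= \sum_(q < x.+1) x %/ q.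
Proof.
rewrite (eq_in_count (a2 := fun j => (d j == x) && (p j <= d j))); last first.
  by move=> j /keep_pos /andP [_ ->]; rewrite andbT.
rewrite (@count_partition _ _ (fun j => p j) x.+1); last by move=> j; lia.
apply: leq_sum => q _; set P := fun _ => _.
have [/hasP [i hi /andP [/andP [/eqP hd _] /eqP hq]]|] := boolP (has P (keep X)); last first.
  by rewrite has_count -leqNgt => h; apply: leq_trans h _.
have := keep_count i X; rewrite hd hq; apply: leq_trans; apply: sub_count => k.
by rewrite /P /cls hd hq => /andP [/andP [-> _] ->].
Qed.

Lemma load_class E i : load (map nj E) -> 0 < p i -> count (cls i) E <= d i %/ p i.
Proof.
move=> /(_ (d i)) hl hp; rewrite leq_divRL //; apply: leq_trans hl.
elim: E => [|j E IH] //=; rewrite big_cons mulnDl.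
case hc: (cls i j); last by case: ifP; lia.
by case/andP: hc => /eqP -> /eqP ->; rewrite leqnn; lia.
Qed.

Lemma exchange Kp E : uniq Kp -> (forall i, i \in Kp -> i < n) ->
  (forall i, i < n -> i \notin Kp ->
    d i %/ p i <= count (fun k => cls i k && (w i <= w k)) Kp) ->
  uniq E -> (forall i, i \in E -> (i < n) && (0 < p i)) -> load (map nj E) ->
  exists E', [/\ uniq E', {subset E' <= Kp}, load (map nj E') &
    wsum (map nj E) <= wsum (map nj E')].
Proof.
move=> uK nK hK; move Em: (count (fun i => (i \notin Kp) && (0 < p i)) E) => m.
elim: m E Em => [|m IH] E Em uE hE hl.
  exists E; split=> // i hi; apply/negP => /negP hn.
  have : has (fun i => (i \notin Kp) && (0 < p i)) E.
    by apply/hasP; exists i => //; have /andP [_ ->] := hE i hi; rewrite hn.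
  by rewrite has_count Em.
have : has (fun i => (i \notin Kp) && (0 < p i)) E by rewrite has_count Em.
case/hasP=> j jE /andP [jK pj]; pose E0 := rem j E.
have pE : perm_eq E (j :: E0) by apply: perm_to_rem.
have uE' : uniq (j :: E0) by rewrite -(perm_uniq pE).
have jn : j < n by case/andP: (hE j jE).
have lE : load (map nj (j :: E0)) by apply: load_perm hl; apply: perm_map.
have [g [gK /andP [cg wg] gE]] : exists g, [/\ g \in Kp, cls j g && (w j <= w g) & g \notin E0].
  have [/hasP [g gK /andP [h1 h2]]|] :=
    boolP (has (fun k => (cls j k && (w j <= w k)) && (k \notin E0)) Kp).
    by exists g.
  move/hasPn => hn; have := load_class lE pj; have := hK j jn jK.
  have cjj : cls j j by rewrite /cls !eqxx.
  rewrite /= cjj -!size_filter => h1 h2.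
  have : size [seq k <- Kp | cls j k && (w j <= w k)] <= size [seq k <- E0 | cls j k];
    last by move=> hs; have := leq_trans h2 (leq_trans h1 hs); rewrite add1n ltnn.
  apply: uniq_leq_size; first exact: filter_uniq.
  move=> k; rewrite !mem_filter => /andP [hk kK]; have := hn k kK; rewrite hk negbK => ->.
  by case/andP: hk => ->.
have [||||E' [h1 h2 h3 h4]] := IH (g :: E0).
- by move: Em; rewrite (permP pE) /= jK pj gK /=; lia.
- by rewrite /= gE; case/andP: uE'.
- move=> i; rewrite inE => /orP [/eqP ->|iE].
    by rewrite nK //; case/andP: cg => /eqP ->.
  by apply: hE; rewrite (perm_mem pE) inE iE orbT.
- move=> x; have := lE x; rewrite /= !big_cons.
  by case/andP: cg => /eqP -> /eqP ->.
exists E'; split=> //; apply: leq_trans h4.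
have -> : wsum (map nj E) = wsum (map nj (j :: E0)) by apply: perm_big; apply: perm_map.
by rewrite /wsum /= !big_cons leq_add2r.
Qed.

Lemma nj_iota : map nj (iota 0 n) = J.
Proof. by rewrite map_nth_iota0 // take_size. Qed.

Lemma perm_indices s : perm_eq J s -> exists2 Is, perm_eq Is (iota 0 n) & s = map nj Is.
Proof. by rewrite perm_sym => /(perm_iotaP (0, 0, 0)). Qed.

Lemma wsum_filter (P : pred nat) s :
  wsum (map nj s) = wsum (map nj (filter P s)) + wsum (map nj (filter (predC P) s)).
Proof.
by rewrite /wsum -big_cat -map_cat /=; apply: perm_big; apply: perm_map; rewrite perm_sym perm_filterC.
Qed.

Lemma opt_value X Kr : perm_eq X (iota 0 n) -> pairwise (fun j k => w j <= w k) X ->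
  perm_eq Kr (keep X) -> sorted (fun i j => d j <= d i) Kr ->
  is_opt J (wsum (map nj [seq i <- iota 0 n | 0 < p i]) - dp (map nj Kr) (dmax J)).
Proof.
move=> pX wX pK sK.
have uX : uniq X by rewrite (perm_uniq pX) iota_uniq.
have uKp : uniq (keep X) by apply: subseq_uniq (keep_subseq X) uX.
have uK : uniq Kr by rewrite (perm_uniq pK).
have XI i : (i \in X) = (i < n) by rewrite (perm_mem pX) mem_iota.
have nK i : i \in keep X -> i < n by move/(mem_subseq (keep_subseq X)); rewrite XI.
have dmaxP i : i < n -> d i <= dmax J.
  by move=> hi; rewrite /dmax (big_nth (0, 0, 0)) big_mkord (bigmax_sup (Ordinal hi)).
set Z := [seq i <- iota 0 n | ~~ (0 < p i)].
set m := dp _ _.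
(* The program adds up only the weights of jobs with [p > 0]; adding the weight of the always early
   jobs [Z] to both terms leaves the difference as it is. *)
have -> : wsum (map nj [seq i <- iota 0 n | 0 < p i]) - m = wsum J - (wsum (map nj Z) + m).
  have -> : wsum J = wsum (map nj [seq i <- iota 0 n | 0 < p i]) + wsum (map nj Z).
    by rewrite -(wsum_filter (fun i => 0 < p i)) nj_iota.
  by rewrite addnC subnDl.
have [|E [hE1 hE2 _ hE4]] := @dp_sound (map nj Kr) (dmax J).
  apply/allP => j /mapP [i]; rewrite (perm_mem pK) => /keep_pos /andP [_ h] -> //.
have [b _ Eb] := subseqP hE1; rewrite -map_mask in Eb; set Ei := mask b Kr in Eb.
have sEi : {subset Ei <= Kr} by move=> i; apply: mem_mask.
have uZE : uniq (Z ++ rev Ei).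
  rewrite cat_uniq filter_uniq ?iota_uniq // rev_uniq mask_uniq // andbT /=.
  apply/hasPn => i; rewrite mem_rev => /sEi; rewrite (perm_mem pK) => /keep_pos /andP [h _].
  by rewrite mem_filter h.
have sZE i : i \in Z ++ rev Ei -> i \in iota 0 n.
  rewrite mem_cat mem_filter mem_rev => /orP [/andP [] //|/sEi].
  by rewrite (perm_mem pK) => /nK; rewrite mem_iota.
pose R := [seq i <- iota 0 n | i \notin Z ++ rev Ei].
(* The witness starts with [Z], which completes at time 0, and continues with the chosen jobs by
   increasing due date. *)
apply: (@is_opt_early _ _ (map nj (Z ++ rev Ei)) (map nj R)).
- rewrite -{1}nj_iota -map_cat; apply: perm_map.
  apply: uniq_perm; first exact: iota_uniq.
    rewrite cat_uniq uZE filter_uniq ?iota_uniq // andbT.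
    by apply/hasPn => i; rewrite mem_filter => /andP [].
  move=> i; rewrite mem_cat mem_filter.
  by case hi: (i \in Z ++ rev Ei) => //=; rewrite sZE.
- have : forall i, i \in Z -> p i = 0 by move=> i; rewrite mem_filter lt0n negbK => /andP [/eqP].
  rewrite map_cat map_rev -Eb; elim: (Z) => [|i Z' IH] //= hZ'.
  have -> : p i = 0 by apply: hZ'; rewrite mem_head.
  by rewrite !addn0 IH // => k hk; apply: hZ'; rewrite inE hk orbT.
- rewrite map_cat /wsum big_cat /=; congr (_ + _).
  rewrite map_rev -Eb /m -hE4; apply: perm_big; by rewrite perm_rev.
move=> E' R' hp hl.
have [Is pIs eIs] := perm_indices hp.
have uIs : uniq Is by rewrite (perm_uniq pIs) iota_uniq.
set k := size E'.
have eE : E' = map nj (take k Is) by rewrite map_take -eIs take_size_cat.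
set F := take k Is in eE.
have uF : uniq F by apply: take_uniq.
have nF i : i \in F -> i < n.
  by move/mem_take; rewrite (perm_mem pIs) mem_iota.
(* The competitor's jobs of length zero weigh at most as much as [Z]; its other jobs are exchanged
   into [keep X]. *)
rewrite eE (wsum_filter (fun i => 0 < p i)) addnC leq_add //.
  set F0 := filter _ F; have sF0 : {subset F0 <= Z}.
    by move=> i; rewrite !mem_filter /= mem_iota => /andP [-> /nF].
  have pZ : perm_eq Z (F0 ++ [seq i <- Z | i \notin F0]).
    rewrite -(perm_filterC (mem F0) Z) perm_cat2r; apply: uniq_perm; first exact/filter_uniq/filter_uniq/iota_uniq.
      exact: filter_uniq.
    by move=> i; rewrite mem_filter inE; case hi: (i \in F0) => //=; rewrite sF0.
  by rewrite /wsum (perm_big _ (perm_map nj pZ)) map_cat big_cat leq_addr.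
set F1 := filter _ F.
have [||||E1 [u1 s1 l1 w1]] := @exchange (keep X) F1 uKp nK.
- move=> i hi hn; exact: keep_full wX i (etrans (XI i) hi) hn.
- exact: filter_uniq.
- by move=> i; rewrite mem_filter => /andP [-> /nF ->].
- apply: load_subseq (_ : load (map nj F)); last by rewrite -eE.
  by apply/map_subseq/filter_subseq.
apply: leq_trans w1 _.
(* [dp_opt] expects a subsequence, so the set [E1] is listed in the order of [Kr]. *)
have pE1 : perm_eq E1 [seq i <- Kr | i \in E1].
  apply: uniq_perm => //; first exact: filter_uniq.
  move=> i; rewrite mem_filter; case hi: (i \in E1) => //=.
  by rewrite (perm_mem pK) s1.
have -> : wsum (map nj E1) = wsum (map nj [seq i <- Kr | i \in E1]).
  by apply: perm_big; apply: perm_map.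
have l2 : load (map nj [seq i <- Kr | i \in E1]).
  by apply: load_perm l1; apply: perm_map.
apply: dp_opt => //.
- by rewrite sorted_map.
- by apply/map_subseq/filter_subseq.
- apply: psum_load l2 _ => j /mapP [i]; rewrite mem_filter => /andP [_ hi] ->.
  by apply: dmaxP; apply: nK; rewrite -(perm_mem pK).
Qed.
End Keep.

(** Dyadic blocks: the [2 ^ k] terms with [2 ^ k <= q < 2 ^ k.+1] are at most [D %/ 2 ^ k] each, so
    together at most [D]. The base case is the term [D %/ 0 = 0]. *)
Lemma harmonic D k : \sum_(q < 2 ^ k) D %/ q <= k * D.
Proof.
elim: k => [|k IH]; first by rewrite big_ord1.
rewrite expnS mul2n -addnn big_split_ord /= mulSn addnC leq_add //.
apply: leq_trans (_ : \sum_(i < 2 ^ k) D %/ 2 ^ k <= _).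
  by apply: leq_sum => i _; apply: leq_div2l; rewrite ?expn_gt0 ?leq_addr.
by rewrite sum_nat_const card_ord mulnC leq_divM.
Qed.

(** * The scheduling program *)

Fixpoint modv (c : cmd) : seq nat :=
  match c with
  | Skip | Sto _ _ _ => [::]
  | Asg x _ => [:: x]
  | Seq c1 c2 | If _ c1 c2 => modv c1 ++ modv c2
  | While _ c => modv c
  end.

Fixpoint moda (c : cmd) : seq nat :=
  match c with
  | Skip | Asg _ _ => [::]
  | Sto a _ _ => [:: a]
  | Seq c1 c2 | If _ c1 c2 => moda c1 ++ moda c2
  | While _ c => moda c
  end.

(** The modified variables and arrays are computed from the syntax, so facts about all others are
    carried across a command by evaluation ([isT]). *)
Definition frame (c : cmd) (s s' : state) :=
  (forall x, x \notin modv c -> vr s' x = vr s x) /\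
  (forall a, a \notin moda c -> forall i, ar s' a i = ar s a i).

Lemma frame_refl c s : frame c s s. Proof. by []. Qed.

Lemma frame_trans c s1 s2 s3 : frame c s1 s2 -> frame c s2 s3 -> frame c s1 s3.
Proof.
move=> [v1 a1] [v2 a2]; split=> [x hx|a ha i]; first by rewrite v2 ?v1.
by rewrite a2 ?a1.
Qed.

Lemma ev_frame V c s t s' : ev V c s t s' -> frame c s s'.
Proof.
elim=> {c s t s'} //=.
- by move=> x e s _; split=> //= y; rewrite inE => /negbTE ->.
- by move=> a e1 e2 s _ _; split=> //= b; rewrite inE => /negbTE ->.
- move=> c1 c2 s t1 s1 t2 s2 _ [v1 a1] _ [v2 a2].
  by split=> /= [x|a]; rewrite mem_cat negb_or => /andP [h1 h2] *; rewrite ?v2 ?v1 ?a2 ?a1.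
- move=> e c1 c2 s t s' _ _ _ [v1 a1].
  by split=> /= [x|a]; rewrite mem_cat negb_or => /andP [h1 h2] *; rewrite ?v1 ?a1.
- move=> e c1 c2 s t s' _ _ _ [v1 a1].
  by split=> /= [x|a]; rewrite mem_cat negb_or => /andP [h1 h2] *; rewrite ?v1 ?a1.
- by move=> e c s t1 s1 t2 s2 _ _ _ f1 _ f2; apply: frame_trans f1 f2.
Qed.

(** The postcondition also receives the elapsed time, and the asserted execution is what
    [compC_steps] turns into a run. *)
Definition wp (V : nat) (c : cmd) (s : state) (Q : nat -> state -> Prop) :=
  exists t s', ev V c s t s' /\ Q t s'.

Section Wp.
Variable V : nat.
Implicit Types (s : state) (Q : nat -> state -> Prop).

Lemma wp_asg x e s Q : ok V s e -> Q 1 (setv s x (eval s e)) -> wp V (Asg x e) s Q.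
Proof. by move=> h q; do 2 eexists; split; [apply: ev_asg|]. Qed.

Lemma wp_sto a e1 e2 s Q : ok V s e1 /\ ok V s e2 ->
  Q 1 (seta s a (eval s e1) (eval s e2)) -> wp V (Sto a e1 e2) s Q.
Proof. by move=> [h1 h2] q; do 2 eexists; split; [apply: ev_sto|]. Qed.

Lemma wp_seq c1 c2 s Q :
  wp V c1 s (fun t1 s1 => wp V c2 s1 (fun t2 s2 => Q (t1 + t2) s2)) ->
  wp V (Seq c1 c2) s Q.
Proof.
move=> [t1 [s1 [h1 [t2 [s2 [h2 q]]]]]].
by exists (t1 + t2), s2; split=> //; apply: ev_seq h1 h2.
Qed.

Lemma wp_skip s Q : Q 0 s -> wp V Skip s Q.
Proof. by move=> q; exists 0, s; split=> //; apply: ev_skip. Qed.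

Lemma wp_if e c1 c2 s Q : ok V s e ->
  (eval s e <> 0 -> wp V c1 s (fun t => Q t.+1)) ->
  (eval s e = 0 -> wp V c2 s (fun t => Q t.+1)) -> wp V (If e c1 c2) s Q.
Proof.
move=> ho h1 h2; case: (eqVneq (eval s e) 0) => [/[dup] he /h2|/eqP/[dup] he /h1].
- by case=> t [s' [h q]]; exists t.+1, s'; split=> //; apply: ev_ifF.
- by case=> t [s' [h q]]; exists t.+1, s'; split=> //; apply: ev_ifT.
Qed.

Lemma wp_conseq c s Q Q' : wp V c s Q ->
  (forall t s', frame c s s' -> Q t s' -> Q' t s') -> wp V c s Q'.
Proof.
by move=> [t [s' [h q]]] hq; exists t, s'; split=> //; apply: hq q; apply: ev_frame h.
Qed.

(** The cost [T i] may vary with the iteration, as the rows of the knapsack phase require. The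
    successors count the tests, the final failing one included. *)
Lemma wp_for e c s n (I : nat -> state -> Prop) (T : nat -> nat) Q : I 0 s ->
  (forall i s', i < n -> I i s' -> frame c s s' ->
    [/\ ok V s' e, eval s' e <> 0 & wp V c s' (fun t s'' => t <= T i /\ I i.+1 s'')]) ->
  (forall s', I n s' -> frame c s s' -> ok V s' e /\ eval s' e = 0) ->
  (forall t s', t <= (\sum_(i < n) (T i).+1).+1 -> I n s' -> frame c s s' -> Q t s') ->
  wp V (While e c) s Q.
Proof.
move=> h0 hstep hend hQ.
suff loop m i s' : n = i + m -> I i s' -> frame c s s' ->
    wp V (While e c) s' (fun t s'' =>
      [/\ t <= (\sum_(i <= j < n) (T j).+1).+1, I n s'' & frame c s s'']).
  have [t [s' [h [h1 h2 h3]]]] := loop n 0 s erefl h0 (frame_refl c s).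
  by exists t, s'; split=> //; apply: hQ => //; rewrite -(big_mkord xpredT (fun i => (T i).+1)).
elim: m i s' => [|m IH] i s' hn hI hf.
  rewrite addn0 in hn; rewrite -{}hn in hI *.
  have [ho he] := hend _ hI hf; exists 1, s'; split; first exact: ev_whileF.
  by split=> //; rewrite ltnS.
have lt : i < n by lia.
have [ho he [t1 [s1 [e1 [l1 I1]]]]] := hstep _ _ lt hI hf.
have f1 := frame_trans hf (ev_frame e1).
have [|t2 [s2 [e2 [l2 I2 f2]]]] := IH i.+1 s1 _ I1 f1; first lia.
exists (t1 + t2).+1, s2; split; first exact: ev_whileT e1 e2.
by split=> //; rewrite (big_ltn lt); lia.
Qed.

(* [I m]: at most [m] iterations remain. *)
Lemma wp_while e c s m (I : nat -> state -> Prop) T Q : I m s ->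
  (forall i s', I i s' -> frame c s s' -> ok V s' e /\ (eval s' e <> 0 ->
    exists2 i', i = i'.+1 & wp V c s' (fun t s'' => t <= T /\ I i' s''))) ->
  (forall t s' i, t <= (m * T.+1).+1 -> I i s' -> frame c s s' -> eval s' e = 0 -> Q t s') ->
  wp V (While e c) s Q.
Proof.
move=> h0 hstep hQ.
suff loop i s' : I i s' -> frame c s s' ->
    wp V (While e c) s' (fun t s'' =>
      [/\ t <= (i * T.+1).+1, exists i', I i' s'', frame c s s'' & eval s'' e = 0]).
  have [t [s' [h [h1 [i h2] h3 h4]]]] := loop m s h0 (frame_refl c s).
  by exists t, s'; split=> //; apply: hQ h2 h3 h4.
elim: i s' => [|i IH] s' hI hf; have [ho hs] := hstep _ _ hI hf;
  case: (eqVneq (eval s' e) 0) => [he|/eqP he];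
  try by exists 1, s'; split; [apply: ev_whileF|split=> //; eexists; apply: hI].
- by case: (hs he).
- have [_ [<-] [t1 [s1 [e1 [l1 I1]]]]] := hs he.
  have f1 := frame_trans hf (ev_frame e1).
  have [t2 [s2 [e2 [l2 I2 f2 z2]]]] := IH s1 I1 f1.
  exists (t1 + t2).+1, s2; split; first exact: ev_whileT e1 e2.
  by split=> //; rewrite mulSn; lia.
Qed.
End Wp.

(** * The algorithm as a while program *)

Local Notation "# v" := (EC v) (at level 2, format "# v").
Local Notation "$ x" := (EV x) (at level 2, format "$ x").
Local Notation "a :+ b" := (EB BAdd a b) (at level 50, left associativity).
Local Notation "a :- b" := (EB BSub a b) (at level 50, left associativity).
Local Notation "a :* b" := (EB BMul a b).
Local Notation "a :/ b" := (EB BDiv a b) (at level 40, left associativity).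
Local Notation "a :< b" := (EB BLt a b) (at level 70, no associativity).
Local Notation "x ::= e" := (Asg x e) (at level 80, no associativity).
Local Notation "c1 ;; c2" := (Seq c1 c2) (at level 90, right associativity).

Local Notation rN := 0 (only parsing).
Local Notation rD := 1 (only parsing).
Local Notation rS := 2 (only parsing).
Local Notation ri := 3 (only parsing).
Local Notation rv := 4 (only parsing).
Local Notation rj := 5 (only parsing).
Local Notation rp := 6 (only parsing).
Local Notation rd := 7 (only parsing).
Local Notation rw := 8 (only parsing).
Local Notation rk := 9 (only parsing).
Local Notation rt := 10 (only parsing).
Local Notation rm := 11 (only parsing).
Local Notation rx := 12 (only parsing).
Local Notation aIn := 0 (only parsing).
Local Notation aTree := 1 (only parsing).
Local Notation aCnt := 2 (only parsing).
Local Notation aNum := 3 (only parsing).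
Local Notation aRow := 4 (only parsing).
Local Notation aF := 5 (only parsing).

Local Notation job_p j := (EA aIn (#3 :* j)) (only parsing).
Local Notation job_w j := (EA aIn (#3 :* j :+ #1)) (only parsing).
Local Notation job_d j := (EA aIn (#3 :* j :+ #2)) (only parsing).

(** A leaf stores [w + 1], which distinguishes a job of weight 0 from an extracted one. *)
Definition scan_body :=
  rd ::= job_d $ri;;
  If ($rD :< $rd) (rD ::= $rd) Skip;;
  If (job_p $ri) (rS ::= $rS :+ job_w $ri) Skip;;
  Sto aTree ($rN :+ $ri) (job_w $ri :+ #1);;
  ri ::= $ri :+ #1.

Definition scan :=
  rD ::= #0;; rS ::= #0;; ri ::= #0;; While ($ri :< $rN) scan_body.

(* Tournament tree: the jobs are the leaves [n .. 2n-1], each inner node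
   [v < n] holds the maximum of its children [2v] and [2v+1]; 0 marks a leaf
   that has been extracted. *)
Definition pull :=
  If (EA aTree (#2 :* $rv) :< EA aTree (#2 :* $rv :+ #1))
     (Sto aTree $rv (EA aTree (#2 :* $rv :+ #1)))
     (Sto aTree $rv (EA aTree (#2 :* $rv))).

Definition build := rv ::= $rN :- #1;; While $rv (pull;; rv ::= $rv :- #1).

(** A node is the maximum of its children: if the left child falls short of it, the value came from
    the right. *)
Definition descend_body :=
  If (EA aTree (#2 :* $rv) :< EA aTree $rv)
     (rv ::= #2 :* $rv :+ #1) (rv ::= #2 :* $rv).

Definition ascend_body := pull;; rv ::= $rv :/ #2.

Definition extract :=
  rv ::= #1;; While ($rv :< $rN) descend_body;;
  Sto aTree $rv #0;; rj ::= $rv :- $rN;;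
  rv ::= $rv :/ #2;; While $rv ascend_body.

Local Notation cnt_idx := ($rd :* ($rD :+ #1) :+ $rp) (only parsing).

(** This runs [keep] online. The counter index separates pairs (d, p) only for [p <= D]; a larger
    [p] may hit a foreign cell, but then [d %/ p = 0] and the test fails whatever is read. Kept jobs
    are put into buckets by due date, with [n] slots per date. *)
Definition select_body :=
  extract;;
  rp ::= job_p $rj;; rd ::= job_d $rj;;
  If (EA aCnt cnt_idx :< $rd :/ $rp)
     (Sto aCnt cnt_idx (EA aCnt cnt_idx :+ #1);;
      Sto aRow ($rd :* $rN :+ EA aNum $rd) $rj;;
      Sto aNum $rd (EA aNum $rd :+ #1))
     Skip;;
  ri ::= $ri :+ #1.

Definition select := ri ::= #0;; While ($ri :< $rN) select_body.

(** [F] is updated in place, with [t] decreasing: as [p > 0] for kept jobs, the entry read lies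
    strictly below [t] and still has its old value. *)
Definition relax_body :=
  rt ::= $rt :- #1;;
  If ($rd :< $rt) (rm ::= $rd) (rm ::= $rt);;
  rx ::= EA aF ($rm :- $rp) :+ $rw;;
  If (EA aF $rt :< $rx) (Sto aF $rt $rx) Skip.

Definition relax := rt ::= $rD :+ #1;; While ($rp :< $rt) relax_body.

Definition row_body :=
  rj ::= EA aRow ($rd :* $rN :+ $rk);;
  rp ::= job_p $rj;; rw ::= job_w $rj;;
  relax;;
  rk ::= $rk :+ #1.

Definition due_body :=
  rk ::= #0;; While ($rk :< EA aNum $rd) row_body;; rd ::= $rd :+ #1.

(** Visiting all dates upwards replaces a sort: each job treated is due no earlier than the previous
    ones, as [dp_opt] requires. *)
Definition knapsack := rd ::= #0;; While ($rd :< $rD :+ #1) due_body.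

Definition algo := scan;; build;; select;; knapsack;; rN ::= $rS :- EA aF $rD.

Lemma wf_algo : wf algo. Proof. by []. Qed.

Lemma index_inj m x q y r : q < m -> r < m -> x * m + q = y * m + r -> x = y /\ q = r.
Proof.
move=> hq hr e; have m0 : 0 < m := leq_ltn_trans (leq0n _) hq.
have ex : x = y.
  by have := congr1 (divn^~ m) e; rewrite /= !divnMDl // !divn_small // !addn0.
by split=> //; move: e; rewrite ex => /addnI.
Qed.

(** * Correctness and cost of each phase *)

Section Algo.
Variables (J : seq job) (V : nat).
Local Notation n := (size J).
Local Notation D := (dmax J).
Local Notation N := (n + maxval J + 2).
Local Notation nj := (nj J).
Local Notation p i := (jp (nj i)).
Local Notation w i := (jw (nj i)).
Local Notation d i := (jd (nj i)).
Hypothesis hn : 0 < n.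
Hypothesis hV : forall a b c, a <= 4 * N -> b <= 4 * N -> c <= 4 * N -> a * b + c < V.

Lemma le_V a : a <= 4 * N -> a < V.
Proof. by move=> h; have := @hV 0 0 a; rewrite mul0n; apply; lia. Qed.

Lemma maxval_job i : i < n -> [/\ p i <= maxval J, w i <= maxval J & d i <= maxval J].
Proof.
move=> hi; have : maxn (p i) (maxn (w i) (d i)) <= maxval J.
  by rewrite /maxval (big_nth (0, 0, 0)) big_mkord (bigmax_sup (Ordinal hi)).
by rewrite !geq_max => /andP [-> /andP [-> ->]].
Qed.

Lemma dmax_job i : i < n -> d i <= D.
Proof. by move=> hi; rewrite /dmax (big_nth (0, 0, 0)) big_mkord (bigmax_sup (Ordinal hi)). Qed.

Lemma dmax_maxval : D <= maxval J.
Proof.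
rewrite /dmax (big_nth (0, 0, 0)) big_mkord; apply/bigmax_leqP => i _.
by have [] := maxval_job (ltn_ord i).
Qed.

Definition inp (s : state) :=
  vr s rN = n /\ forall i, i < n ->
    [/\ ar s aIn (3 * i) = p i, ar s aIn (3 * i + 1) = w i & ar s aIn (3 * i + 2) = d i].

Lemma inp_init s : vr s 0 = n -> (forall i, ar s 0 i = init_mem J i.+1) -> inp s.
Proof.
move=> h0 hi; split=> // i lti; rewrite !hi /init_mem /= /nj.
have -> : (3 * i) %/ 3 = i by lia.
have -> : (3 * i) %% 3 = 0 by lia.
have -> : (3 * i + 1) %/ 3 = i by lia.
have -> : (3 * i + 1) %% 3 = 1 by lia.
have -> : (3 * i + 2) %/ 3 = i by lia.
have -> : (3 * i + 2) %% 3 = 2 by lia.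
by rewrite lti.
Qed.

Lemma inp_frame c s s' : 0 \notin modv c -> 0 \notin moda c -> frame c s s' -> inp s -> inp s'.
Proof.
move=> hv ha [fv fa] [h0 hi]; split; first by rewrite fv.
by move=> i /hi; rewrite !fa.
Qed.

Lemma sum_w_bound (P : pred nat) i : i <= n ->
  \sum_(0 <= k < i) (if P k then w k else 0) <= i * maxval J.
Proof.
elim: i => [|i IH] hi; first by rewrite big_geq.
rewrite big_nat_recr //= mulSnr; have [_ h _] := maxval_job hi.
by apply: leq_add; [apply: IH; exact: ltnW|case: ifP].
Qed.

Lemma wp_scan s : inp s -> wp V scan s (fun t s' =>
  [/\ t <= 8 * n + 4, vr s' rD = D, vr s' rS = wsum (map nj [seq i <- iota 0 n | 0 < p i]) &
    forall i, i < n -> ar s' aTree (n + i) = (w i).+1]).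
Proof.
move=> hin; do 3 (apply: wp_seq; apply: wp_asg; first by []).
apply: (@wp_for _ _ _ _ n (fun i s => [/\ vr s ri = i, vr s rD = \max_(0 <= k < i) d k,
  vr s rS = \sum_(0 <= k < i) (if 0 < p k then w k else 0) &
  forall k, k < i -> ar s aTree (n + k) = (w k).+1]) (fun _ => 7)).
- by split=> //=; rewrite big_geq.
- move=> i s1 hi [vi vD vS hT] hf.
  have hin1 : inp s1 by exact: inp_frame hf _.
  have [eN eJ] := hin1; have [ep ew ed] := eJ i hi; have [lp lw ld] := maxval_job hi.
  split; [by []|by rewrite /= eN vi hi|].
  have i3 : 3 * i + 2 < V by apply: hV; lia.
  apply: wp_seq; apply: wp_asg; first by rewrite /= vi; repeat split; lia.
  rewrite /= vi ed; set s2 := setv _ _ _.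
  apply: wp_seq; apply: (@wp_conseq _ _ _
    (fun t s' => t <= 2 /\ vr s' rD = maxn (vr s1 rD) (d i))).
    apply: wp_if => //= hc.
      by apply: wp_asg => //=; split=> //; lia.
    by apply: wp_skip; split=> //=; lia.
  move=> t2 s3 f3 [l3 v3].
  have hS : \sum_(0 <= k < i) (if 0 < p k then w k else 0) + w i < V.
    have := @sum_w_bound (fun k => 0 < p k) i (ltnW hi) => hs.
    by have := @hV n (maxval J) (maxval J); nia.
  have vi3 : vr s3 ri = i by rewrite (f3.1 3 isT).
  have e3 : [/\ ar s3 aIn (3 * i) = p i & ar s3 aIn (3 * i + 1) = w i].
    by rewrite !(f3.2 0 isT).
  have [e3p e3w] := e3.
  apply: wp_seq; apply: (@wp_conseq _ _ _
    (fun t s' => t <= 2 /\ vr s' rS = vr s1 rS + (if 0 < p i then w i else 0))).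
    apply: wp_if => /=; first by rewrite vi3; repeat split; lia.
      rewrite vi3 e3p => hp; apply: wp_asg.
        by rewrite /= vi3 e3w (f3.1 2 isT) /= vS; repeat split; lia.
      by rewrite /= vi3 e3w (f3.1 2 isT) /= lt0n; case: eqP.
    by rewrite vi3 e3p => ->; apply: wp_skip; rewrite (f3.1 2 isT) /= addn0.
  move=> t3 s4 f4 [l4 v4].
  have vi4 : vr s4 ri = i by rewrite (f4.1 3 isT).
  have e4w : ar s4 aIn (3 * i + 1) = w i by rewrite !(f4.2 0 isT).
  have eN4 : vr s4 rN = n by rewrite (f4.1 0 isT) (f3.1 0 isT).
  apply: wp_seq; apply: wp_sto.
    by rewrite /= vi4 e4w eN4; repeat split; try lia; apply: le_V; lia.
  apply: wp_asg; first by rewrite /= vi4; repeat split; apply: le_V; lia.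
  rewrite /= vi4 e4w eN4; split; first lia.
  split=> /=.
  + by rewrite addn1.
  + by rewrite (f4.1 1 isT) v3 vD big_nat_recr.
  + by rewrite v4 vS big_nat_recr.
  + move=> k hk; case: eqP => hki; first by have -> : k = i; lia.
    by rewrite (f4.2 1 isT) (f3.2 1 isT) /= hT //; lia.
- move=> s1 [vi _ _ _] hf; have [eN _] : inp s1 by exact: inp_frame hf _.
  by rewrite /= eN vi ltnn.
- move=> t s1 ht [_ vD vS hT] hf; split=> //.
  + by move: ht; rewrite sum_nat_const card_ord; lia.
  + by rewrite vD /dmax [RHS](big_nth (0, 0, 0)).
  + by rewrite vS /wsum big_map big_filter /index_iota subn0 [RHS]big_mkcond.
Qed.

Definition heap_at (T : nat -> nat) u := T u = maxn (T (2 * u)) (T (2 * u + 1)).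

Lemma wp_pull s Q : 2 * vr s rv + 1 < V ->
  Q 2 (seta s aTree (vr s rv) (maxn (ar s aTree (2 * vr s rv)) (ar s aTree (2 * vr s rv + 1)))) ->
  wp V pull s Q.
Proof.
move=> hb hQ; apply: wp_if => /=; first by repeat split; lia.
- move=> hc; apply: wp_sto; first by rewrite /=; repeat split; lia.
  by move: hQ; rewrite (maxn_idPr _) //; move: hc => /=; case: ltnP => // /ltnW.
- move=> hc; apply: wp_sto; first by rewrite /=; repeat split; lia.
  by move: hQ; rewrite (maxn_idPl _) //; move: hc => /=; case: ltnP.
Qed.

Lemma wp_build s : vr s rN = n -> wp V build s (fun t s' =>
  [/\ t <= 4 * n, forall u, 0 < u < n -> heap_at (ar s' aTree) u &
    forall u, n <= u -> ar s' aTree u = ar s aTree u]).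
Proof.
move=> eN; apply: wp_seq; apply: wp_asg => //=; rewrite eN.
apply: (@wp_for _ _ _ _ n.-1 (fun i s1 => [/\ vr s1 rv = n - 1 - i,
  forall u, n - 1 - i < u < n -> heap_at (ar s1 aTree) u &
  forall u, n <= u -> ar s1 aTree u = ar s aTree u]) (fun _ => 3)).
- by split=> //= [|u]; lia.
- move=> i s1 hi [vi hh hl] hf; split=> //=; first lia.
  apply: wp_seq; apply: wp_pull; first by apply: le_V; lia.
  apply: wp_asg => //=; split=> //; split=> /=; first lia.
  + move=> u hu; rewrite /heap_at /=.
    rewrite (_ : (2 * u == _) = false) 1?(_ : (2 * u + 1 == _) = false); try lia.
    by case: eqP => [->|ne] //; apply: hh; lia.
  + by move=> u hu; rewrite ifF ?hl //; lia.
- by move=> s1 [vi _ _] _ /=; split=> //; lia.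
- move=> t s1 ht [_ hh hl] _; split=> //.
  + by move: ht; rewrite sum_nat_const card_ord; lia.
  + by move=> u hu; apply: hh; lia.
Qed.

(** The parent [u %/ 2] of a node with [1 < u < 2 * n] is an inner node, for every [n], so values
    never decrease on the way up to 1. *)
Lemma heap_root T : (forall u, 0 < u < n -> heap_at T u) ->
  forall u, 0 < u < 2 * n -> T u <= T 1.
Proof.
move=> hh u; have [m hm] := ubnP u; elim: m u hm => // m IH u hm hu.
have [->|hu1] := eqVneq u 1; first by [].
apply: leq_trans (IH (u %/ 2) _ _); try lia.
rewrite (hh (u %/ 2)); last lia.
have e : u = 2 * (u %/ 2) \/ u = 2 * (u %/ 2) + 1 by lia.
by case: e => {1}->; rewrite leq_max leqnn ?orbT.
Qed.

Local Notation lg := (trunc_log 2 n).+1.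

Lemma n_lt_lg : n < 2 ^ lg. Proof. exact: trunc_log_ltn. Qed.

Lemma wp_extract s : vr s rN = n -> (forall u, 0 < u < n -> heap_at (ar s aTree) u) ->
  wp V extract s (fun t s' => [/\ t <= 7 * lg + 6, vr s' rj < n,
    forall u, 0 < u < n -> heap_at (ar s' aTree) u,
    forall i, i < n -> ar s aTree (n + i) <= ar s aTree (n + vr s' rj) &
    forall i, i < n -> ar s' aTree (n + i) = if i == vr s' rj then 0 else ar s aTree (n + i)]).
Proof.
move=> eN hh; apply: wp_seq; apply: wp_asg => //=; set s0 := setv _ _ _.
(* Each descent at least doubles the node, so [n <= v * 2 ^ m] leaves at most [m] descents. *)
apply: wp_seq; apply: (@wp_while _ _ _ _ lg (fun m s1 => [/\ 0 < vr s1 rv < 2 * n,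
  ar s aTree (vr s1 rv) = ar s aTree 1 & n <= vr s1 rv * 2 ^ m]) 2).
- by split=> //=; [lia | rewrite mul1n ltnW // n_lt_lg].
- move=> m s1 [hv eT hm] hf.
  have eN1 : vr s1 rN = n by rewrite (hf.1 0 isT).
  have eA u : ar s1 aTree u = ar s aTree u by rewrite (hf.2 1 isT).
  split=> //=; rewrite eN1; case: ltnP => // hlt _.
  case: m hm => [|m] hm; first by move: hm; rewrite muln1; lia.
  exists m => //; have hv1 : 0 < vr s1 rv < n by lia.
  have hT := hh _ hv1; rewrite /heap_at in hT.
  have b1 : 2 * vr s1 rv + 1 < V by apply: le_V; lia.
  rewrite expnS mulnA in hm.
  apply: wp_if => /=; first by repeat split; lia.
    rewrite !eA; case: ltnP => // hc _; apply: wp_asg; first by repeat split => /=; lia.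
    split=> //; split=> /=; first lia.
      by rewrite -eT hT; move: hc; rewrite hT; lia.
    by nia.
  rewrite !eA; case: ltnP => // hc _; apply: wp_asg; first by repeat split => /=; lia.
  split=> //; split=> /=; first lia.
    by rewrite -eT hT; move: hc; rewrite hT; lia.
  by nia.
move=> t1 s1 m l1 [hv eT _] f1 /= hc.
have eN1 : vr s1 rN = n by rewrite (f1.1 0 isT).
have eA u : ar s1 aTree u = ar s aTree u by rewrite (f1.2 1 isT).
have {}hc : n <= vr s1 rv by move: hc; rewrite eN1; case: ltnP.
apply: wp_seq; apply: wp_sto => //=.
apply: wp_seq; apply: wp_asg => //=.
apply: wp_seq; apply: wp_asg => //=.
rewrite eN1; set v := vr s1 rv in hv eT hc *; set s2 := setv _ _ _.
have hv2 : v %/ 2 < 2 ^ lg by have := n_lt_lg; lia.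
(* Only the node about to be recomputed may violate the heap equation, and none does once it is 0.
   The bound [2 ^ m] counts the remaining halvings. *)
apply: (@wp_while _ _ _ _ lg (fun m s' => [/\ vr s' rv < 2 ^ m, vr s' rv < n,
  forall u, 0 < u < n -> u <> vr s' rv -> heap_at (ar s' aTree) u &
  forall u, n <= u -> ar s' aTree u = ar s2 aTree u]) 3).
- split=> //=; first lia.
  move=> u hu hne; rewrite /heap_at /= !eA.
  by rewrite !ifF; [apply: hh|lia|lia|lia].
- move=> k s3 [h1 h2 h3 h4] hf; split=> //= hne.
  case: k h1 => [|k] h1; first by move: h1; rewrite expn0; lia.
  exists k => //; apply: wp_seq; apply: wp_pull; first by apply: le_V; lia.
  apply: wp_asg => //=; split=> //; split=> /=.
  + by move: h1; rewrite expnS; lia.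
  + by lia.
  + move=> u hu hu2; rewrite /heap_at /=.
    rewrite (_ : (2 * u == _) = false) 1?(_ : (2 * u + 1 == _) = false); try lia.
    by case: eqP => [->|ne] //; apply: h3; lia.
  + by move=> u hu; rewrite ifF ?h4 //; lia.
move=> t3 s3 k l3 [_ _ h3 h4] f3 /= h0.
have ej : vr s3 rj = v - n by rewrite (f3.1 5 isT).
rewrite ej; split.
- by lia.
- by lia.
- by move=> u hu; apply: h3 => //; rewrite h0; lia.
- move=> i hi; have -> : n + (v - n) = v by lia.
  by rewrite eT; apply: heap_root => //; lia.
- move=> i hi; rewrite h4 /=; last lia.
  by rewrite eA; case: eqP; case: eqP => //; lia.
Qed.

Local Notation keep := (keep J).
Local Notation cls := (cls J).

Definition row X x := [seq j <- keep X | d j == x].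

(** The latest kept job heads [keep X] but occupies the last used slot of its row, hence [rev]. The
    bounds by [D] make the counter index injective. *)
Definition tables X (s : state) :=
  [/\ forall x q, x <= D -> q <= D ->
        ar s aCnt (x * (D + 1) + q) = count (fun k => (p k == q) && (d k == x)) (keep X),
      forall x, ar s aNum x = size (row X x) &
      forall x k, k < size (row X x) -> ar s aRow (x * n + k) = nth 0 (rev (row X x)) k].

Definition extracted X (s : state) :=
  [/\ uniq X, forall j, j \in X -> j < n, pairwise (fun j k => w j <= w k) X,
      forall j, j < n -> ar s aTree (n + j) = if j \in X then 0 else (w j).+1 &
      forall j k, j \in X -> k < n -> k \notin X -> w k <= w j].

Lemma size_row X x : size (row X x) <= size X.
Proof. by rewrite size_filter (leq_trans (count_size _ _)) // size_subseq // keep_subseq. Qed.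

Lemma extracted_step X s j s' : extracted X s -> size X < n -> j < n ->
  (forall i, i < n -> ar s aTree (n + i) <= ar s aTree (n + j)) ->
  (forall i, i < n -> ar s' aTree (n + i) = if i == j then 0 else ar s aTree (n + i)) ->
  extracted (j :: X) s' /\ j \notin X.
Proof.
move=> [uX nX pX hT hm] sX hj hmax hT'.
have jX : j \notin X.
  (* If the leaf found were already erased, the maximum would be 0 and all [n] jobs would have been
     extracted. *)
  apply/negP => jX; suff : size (iota 0 n) <= size X by rewrite size_iota; lia.
  apply: uniq_leq_size; first exact: iota_uniq.
  move=> k; rewrite mem_iota => hk; apply/negPn/negP => kX.
  by have := hmax k hk; rewrite !hT // jX (negbTE kX).
have hmw k : k < n -> k \notin X -> w k <= w j.
  by move=> hk kX; have := hmax k hk; rewrite !hT // (negbTE jX) (negbTE kX).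
split=> //; split=> /=.
- by rewrite jX.
- by move=> k; rewrite inE => /orP [/eqP -> //|/nX].
- rewrite pX andbT; apply/allP => k kX; exact: hm.
- by move=> k hk; rewrite hT' // hT // inE; case: eqP.
- move=> k l; rewrite !inE negb_or => /orP [/eqP -> hl /andP [_ lX]|kX hl /andP [_ lX]].
    exact: hmw.
  exact: hm.
Qed.

Lemma wp_select s : inp s -> vr s rD = D ->
  (forall u, 0 < u < n -> heap_at (ar s aTree) u) ->
  (forall i, i < n -> ar s aTree (n + i) = (w i).+1) ->
  (forall a i, 1 < a -> ar s a i = 0) ->
  wp V select s (fun t s' => t <= n * (7 * lg + 14) + 2 /\
    exists X, [/\ perm_eq X (iota 0 n), pairwise (fun j k => w j <= w k) X & tables X s']).
Proof.
move=> hin eD hh hT h0; have hDm := dmax_maxval.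
apply: wp_seq; apply: wp_asg => //=; set s0 := setv _ _ _.
apply: (@wp_for _ _ _ _ n (fun i s1 => vr s1 ri = i /\
  (forall u, 0 < u < n -> heap_at (ar s1 aTree) u) /\
  exists X, [/\ size X = i, extracted X s1 & tables X s1]) (fun _ => 7 * lg + 13)).
- split=> //; split=> //; exists [::]; split=> //.
  by split=> // x *; rewrite /= h0.
- move=> i s1 hi [vi [hh1 [X [sX exX [hc hnum hrow]]]]] hf.
  have hin1 : inp s1 by exact: inp_frame hf hin.
  have [eN1 _] := hin1; have eD1 : vr s1 rD = D by rewrite (hf.1 1 isT).
  split=> //; first by rewrite /= vi eN1 hi.
  apply: wp_seq; apply: (wp_conseq (wp_extract eN1 hh1)).
  move=> t2 s2 f2 [l2 hj hh2 hmax hT2]; set j := vr s2 rj in hj hmax hT2.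
  have [exX' jX] := extracted_step exX (etrans (congr1 (fun x => x < n) sX) hi) hj hmax hT2.
  have [_ eJ] := inp_frame (isT : 0 \notin modv extract) isT f2 hin1.
  have [ep ew ed] := eJ j hj; have [lp lw ld] := maxval_job hj; have ldD := dmax_job hj.
  have eD2 : vr s2 rD = D by rewrite (f2.1 1 isT).
  have eN2 : vr s2 rN = n by rewrite (f2.1 0 isT).
  have vi2 : vr s2 ri = i by rewrite (f2.1 3 isT).
  have jV : 3 * j + 2 < V by apply: hV; lia.
  apply: wp_seq; apply: wp_asg; first by rewrite /= -/j; lia.
  apply: wp_seq; apply: wp_asg; first by rewrite /= -/j; repeat split; lia.
  rewrite /= -/j ep ed.
  have idxV : d j * (D + 1) + p j < V by apply: hV; lia.
  have sumV : D + 1 < V by apply: le_V; lia.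
  have prodV : d j * (D + 1) < V by lia.
  have ecnt : 0 < d j %/ p j ->
      ar s2 aCnt (d j * (D + 1) + p j) = count (cls j) (keep X).
    move=> hq; rewrite (f2.2 2 isT) hc //.
    by move: hq; case: (p j) => [|q]; rewrite ?divn0 // divn_gt0 // => hq; lia.
  have cX Q : count Q (keep X) <= n.
    rewrite (leq_trans (count_size _ _)) //.
    by rewrite (leq_trans (size_subseq (keep_subseq _ _))) // sX ltnW.
  have etest : (ar s2 aCnt (d j * (D + 1) + p j) < d j %/ p j) =
      (count (cls j) (keep X) < d j %/ p j).
    by case: (posnP (d j %/ p j)) => [->|/ecnt ->].
  have hc2 x q : x <= D -> q <= D ->
     ar s2 aCnt (x * (D + 1) + q) = count (fun k => (p k == q) && (d k == x)) (keep X).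
    by move=> *; rewrite (f2.2 2 isT) hc.
  have hnum2 x : ar s2 aNum x = size (row X x) by rewrite (f2.2 3 isT).
  have hrow2 x k : k < size (row X x) -> ar s2 aRow (x * n + k) = nth 0 (rev (row X x)) k.
    by move=> *; rewrite (f2.2 4 isT) hrow.
  set s3 := setv (setv _ _ _) _ _.
  apply: wp_seq; apply: (@wp_conseq _ _ _ (fun t s' => t <= 4 /\ tables (j :: X) s')).
    apply: wp_if; first by rewrite /= eD2; repeat split; lia.
    + rewrite /= eD2 etest; case hlt : (_ < _) => // _.
      have hq : 0 < d j %/ p j by lia.
      have [p0 pd] : 0 < p j /\ p j <= d j.
        by move: hq; case: (p j) => [|q]; rewrite ?divn0 // divn_gt0.
      have ek : keep (j :: X) = j :: keep X by rewrite /= hlt.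
      have rk x : row (j :: X) x = if d j == x then j :: row X x else row X x.
        by rewrite /row ek.
      have srow : size (row X (d j)) < n by rewrite (leq_ltn_trans (size_row _ _)) ?sX.
      apply: wp_seq; apply: wp_sto.
        rewrite /= eD2 ecnt //; repeat split; try lia.
        by apply: le_V; have := cX (cls j); lia.
      rewrite /= eD2 ecnt //.
      have rowV : d j * n + size (row X (d j)) < V by apply: hV; lia.
      apply: wp_seq; apply: wp_sto; first by rewrite /= eN2 hnum2; repeat split; lia.
      apply: wp_sto; first by rewrite /= hnum2; repeat split; apply: le_V; lia.
      rewrite /= -/j eN2 hnum2; split=> //; split.
      * move=> x q hx hq'; rewrite ek /=.
        have -> : (x * (D + 1) + q == d j * (D + 1) + p j) = (p j == q) && (d j == x).
          apply/eqP/andP => [e|[/eqP -> /eqP ->] //].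
          have [ex eq'] : x = d j /\ q = p j by apply: (@index_inj (D + 1)) => //; lia.
          by rewrite ex eq' !eqxx.
        rewrite hc2 //; case: andP => [[/eqP <- /eqP <-]|_]; last by rewrite add0n.
        by rewrite addnC.
      * move=> x; rewrite rk /= [x == _]eq_sym; case: eqP => [<-|_]; last exact: hnum2.
        by rewrite addn1.
      * move=> x k; rewrite rk /=; case: (eqVneq (d j) x) => [<-|ne] hk.
          rewrite rev_cons nth_rcons size_rev eqn_add2l.
          move: hk => /=; rewrite ltnS leq_eqVlt; case: eqP => [-> _|_ /= hk].
            by rewrite ltnn.
          by rewrite hk hrow2.
        rewrite ifF ?hrow2 //; apply/eqP => e; case/eqP: ne.
        have hkn : k < n by rewrite (leq_trans hk) // (leq_trans (size_row _ _)) // sX ltnW.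
        by have [] := @index_inj n x k (d j) _ hkn srow e.
    + rewrite /= eD2 etest; case hlt : (_ < _) => // _; apply: wp_skip; split=> //.
      have ek : keep (j :: X) = keep X by rewrite /= hlt.
      by split=> [x q|x|x k]; rewrite /row ek; [apply: hc2|apply: hnum2|apply: hrow2].
  move=> t4 s4 f4 [l4 tb4].
  have vi4 : vr s4 ri = i by rewrite (f4.1 3 isT).
  apply: wp_asg; first by rewrite /= vi4; repeat split; apply: le_V; lia.
  rewrite /= vi4; split; first lia.
  split; first by rewrite /= addn1.
  split; first by move=> u hu; rewrite /heap_at /= !(f4.2 1 isT); apply: hh2.
  exists (j :: X); split=> //=; first by rewrite sX.
  case: exX' => a1 a2 a3 a4 a5; split=> //.
  by move=> k hk; rewrite /= (f4.2 1 isT) a4.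
- move=> s1 [vi _] hf; have [eN _] : inp s1 by exact: inp_frame hf hin.
  by rewrite /= eN vi ltnn.
- move=> t s1 ht [_ [_ [X [sX [uX nX pX _ _] tb]]]] _; split.
    by move: ht; rewrite sum_nat_const card_ord; lia.
  exists X; split=> //; apply: uniq_perm; rewrite ?iota_uniq //.
  have [|||_ //] := @uniq_min_size _ X (iota 0 n) => //; last by rewrite size_iota sX.
  by move=> k /nX; rewrite mem_iota.
Qed.

Lemma wsum_bound L : {in L, forall j, j < n} -> wsum (map nj L) <= size L * maxval J.
Proof.
rewrite /wsum; elim: L => [|j L IH] hL; first by rewrite big_nil.
rewrite /= big_cons mulSn leq_add //; last by apply: IH => k hk; apply: hL; rewrite inE hk orbT.
by have [] := maxval_job (hL j (mem_head _ _)).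
Qed.

Lemma wp_relax s j Kr : vr s rD = D -> j < n -> 0 < p j <= d j -> vr s rp = p j ->
  vr s rw = w j -> vr s rd = d j -> uniq (j :: Kr) -> {in Kr, forall k, k < n} ->
  (forall t, t <= D -> ar s aF t = dp (map nj Kr) t) ->
  wp V relax s (fun t s' => t <= 7 * D + 9 /\
    forall t, t <= D -> ar s' aF t = dp (map nj (j :: Kr)) t).
Proof.
move=> eD hj /andP [p0 pd] ep ew ed uK nK hF; have hDm := dmax_maxval.
have ldD := dmax_job hj; have [lp lw ld] := maxval_job hj.
have nK' : {in j :: Kr, forall k, k < n}.
  by move=> k; rewrite inE => /orP [/eqP -> //|/nK].
have sz : size (j :: Kr) <= n.
  by rewrite -[n](size_iota 0); apply: uniq_leq_size => // k /nK'; rewrite mem_iota.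
have dpV t : dp (map nj Kr) t + w j < V.
  have := wsum_bound nK'; have := dp_wsum (map nj Kr) t; rewrite /wsum /= big_cons => h1 h2.
  have h3 : (size Kr).+1 * maxval J <= n * maxval J by rewrite leq_mul2r sz orbT.
  have := @hV n (maxval J) 0; lia.
apply: wp_seq; apply: wp_asg; first by rewrite /= eD; repeat split; apply: le_V; lia.
rewrite /= eD; set s0 := setv _ _ _.
apply: (@wp_for _ _ _ _ (D + 1 - p j) (fun i s1 => vr s1 rt = D + 1 - i /\
  forall t, t <= D -> ar s1 aF t = dp (map nj (if D + 1 - i <= t then j :: Kr else Kr)) t)
  (fun _ => 6)).
- by split=> /= [|t ht]; [rewrite subn0|rewrite ifF ?hF //; lia].
- move=> i s1 hi [et hF1] hf.
  have [ep1 ew1 ed1] : [/\ vr s1 rp = p j, vr s1 rw = w j & vr s1 rd = d j].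
    by rewrite (hf.1 6 isT) (hf.1 8 isT) (hf.1 7 isT).
  split=> //=; first by rewrite ep1 et; case: ltnP => //; lia.
  apply: wp_seq; apply: wp_asg => //=.
  set t := vr s1 rt - 1; have ht : p j <= t <= D by rewrite /t et; lia.
  have et' : t = D - i by rewrite /t et; lia.
  apply: wp_seq; apply: (@wp_conseq _ _ _ (fun q s' => q <= 2 /\ vr s' rm = minn t (d j))).
    apply: wp_if => //= hc; apply: wp_asg => //=; split=> //.
      by move: hc; rewrite ed1; case: ltnP => // h _; rewrite (minn_idPr (ltnW h)).
    by move: hc; rewrite ed1; case: ltnP => // h _; rewrite (minn_idPl h).
  move=> t2 s2 f2 [l2 em].
  have [et2 ep2 ew2] : [/\ vr s2 rt = t, vr s2 rp = p j & vr s2 rw = w j].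
    by rewrite (f2.1 10 isT) (f2.1 6 isT) (f2.1 8 isT) /= ep1 ew1.
  have hF2 u : u <= D -> ar s2 aF u = dp (map nj (if D + 1 - i <= u then j :: Kr else Kr)) u.
    by move=> hu; rewrite (f2.2 5 isT) /= hF1.
  have eF : ar s2 aF (minn t (d j) - p j) = dp (map nj Kr) (minn t (d j) - p j).
    by rewrite hF2 ?ifF //; lia.
  have eFt : ar s2 aF t = dp (map nj Kr) t by rewrite hF2 ?ifF //; lia.
  apply: wp_seq; apply: wp_asg; first by rewrite /= em ep2 ew2 eF; repeat split.
  rewrite /= em ep2 ew2 eF; set x := _ + w j.
  have goal3 s3 : (forall u, ar s3 aF u = if u == t then maxn (ar s2 aF t) x else ar s2 aF u) ->
      forall u, u <= D -> ar s3 aF u = dp (map nj (if D + 1 - i.+1 <= u then j :: Kr else Kr)) u.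
    move=> h u hu; rewrite h; case: eqP => [->|ne].
      by rewrite ifT; [rewrite /= eFt ifT //; lia|lia].
    by rewrite hF2 // (_ : (D + 1 - i <= u) = (D + 1 - i.+1 <= u)) //; lia.
  have ett : t = D + 1 - i.+1 by lia.
  apply: wp_if => //= hc.
    apply: wp_sto => //; split; first lia.
    split; first by rewrite /= et2.
    apply: (goal3 (seta s2 aF (vr s2 rt) x)) => u /=; rewrite et2; case: eqP => // _.
    by move: hc; rewrite et2; case: ltnP => // h _; rewrite (maxn_idPr (ltnW h)).
  apply: wp_skip; split; first lia.
  split; first by rewrite /= et2.
  apply: goal3 => u /=; case: eqP => // ->.
  by move: hc; rewrite et2; case: ltnP => // h _; rewrite (maxn_idPl h).
- move=> s1 [et _] hf; split=> //=; rewrite (hf.1 6 isT) et /= ep.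
  by case: ltnP => //; lia.
- move=> t s1 ht [_ h1] _; split; first by move: ht; rewrite sum_nat_const card_ord; lia.
  (* Entries below [p] are never visited; there the job does not fit and [dp] ignores it. *)
  move=> u hu; rewrite h1 //; case: ifP => // hlt /=; rewrite ifF //; lia.
Qed.

Lemma wp_row s X Kr : inp s -> vr s rD = D -> vr s rd <= D -> uniq X ->
  (forall j, j \in X -> j < n) -> tables X s ->
  uniq (row X (vr s rd) ++ Kr) -> {in Kr, forall k, k < n} ->
  (forall t, t <= D -> ar s aF t = dp (map nj Kr) t) ->
  wp V due_body s (fun t s' => t <= size (row X (vr s rd)) * (7 * D + 14) + 3 /\
    vr s' rd = vr s rd + 1 /\
    forall t, t <= D -> ar s' aF t = dp (map nj (row X (vr s rd) ++ Kr)) t).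
Proof.
move=> hin eD hd uX nX [hc hnum hrow] uK nK hF; have hDm := dmax_maxval.
set x := vr s rd in hd uK *; set R := rev (row X x).
have sR : size R = size (row X x) by rewrite size_rev.
have nR j : j \in R -> [/\ j < n, 0 < p j <= d j & d j = x].
  rewrite mem_rev mem_filter => /andP [/eqP ex hk]; split=> //; last exact: keep_pos hk.
  by apply: nX; apply: mem_subseq (keep_subseq J X) _ hk.
have szn : size R <= n.
  rewrite sR (leq_trans (size_row _ _)) // -[n](size_iota 0); apply: uniq_leq_size => // k /nX.
  by rewrite mem_iota.
apply: wp_seq; apply: wp_asg => //=; set s0 := setv _ _ _.
apply: wp_seq; apply: (@wp_for _ _ _ _ (size R) (fun k s1 => vr s1 rk = k /\
  forall t, t <= D -> ar s1 aF t = dp (map nj (rev (take k R) ++ Kr)) t)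
  (fun _ => 7 * D + 13)).
- by split=> // t ht; rewrite take0 /= hF.
- move=> k s1 hk [ek hF1] hf.
  have hin1 : inp s1 by exact: inp_frame hf hin.
  have ed1 : vr s1 rd = x by rewrite (hf.1 7 isT).
  have [eN1 eJ] := hin1.
  set j := nth 0 R k; have [hj hp hdx] := nR j (mem_nth _ hk).
  have [ep ew ed] := eJ j hj; have [lp lw ld] := maxval_job hj.
  have hnum1 : ar s1 aNum x = size R by rewrite (hf.2 3 isT) /= hnum sR.
  have hrow1 : ar s1 aRow (x * n + k) = j by rewrite (hf.2 4 isT) /= hrow // -sR.
  split=> //; first by rewrite /= ek ed1 hnum1 hk.
  have jV : 3 * j + 1 < V by apply: hV; lia.
  have rV : x * n + k < V by apply: hV; lia.
  apply: wp_seq; apply: wp_asg; first by rewrite /= ed1 eN1 ek; repeat split; lia.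
  rewrite /= ed1 eN1 ek hrow1.
  apply: wp_seq; apply: wp_asg; first by rewrite /=; lia.
  apply: wp_seq; apply: wp_asg; first by rewrite /=; repeat split; lia.
  rewrite /= ep ew; set s2 := setv _ _ _.
  have et : rev (take k.+1 R) = j :: rev (take k R) by rewrite (take_nth 0) // rev_rcons.
  apply: wp_seq; apply: (wp_conseq (@wp_relax s2 j (rev (take k R) ++ Kr) _ hj hp _ _ _ _ _ _)).
  + by rewrite /= (hf.1 1 isT).
  + by [].
  + by [].
  + by rewrite /= ed1 hdx.
  + rewrite -cat_cons -et; move: uK; rewrite !cat_uniq rev_uniq.
    move=> /and3P [h1 h2 ->]; rewrite take_uniq ?rev_uniq // andbT /=.
    apply/hasPn => i hi; move/hasPn/(_ i hi): h2; apply: contra.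
    by rewrite mem_rev => /mem_take; rewrite mem_rev.
  + by move=> i; rewrite mem_cat mem_rev => /orP [/mem_take /nR [] //|/nK].
  + by [].
  move=> t3 s3 f3 [l3 hF3].
  have ek3 : vr s3 rk = k by rewrite (f3.1 9 isT).
  apply: wp_asg; first by rewrite /= ek3; repeat split; apply: le_V; lia.
  rewrite /= ek3; split; first lia.
  by split=> /= [|t ht]; [rewrite addn1|rewrite hF3 // et].
- move=> s1 [ek _] hf; split=> //=.
  by rewrite ek (hf.1 7 isT) (hf.2 3 isT) /= hnum sR ltnn.
move=> t1 s1 l1 [_ hF1] hf.
have ed1 : vr s1 rd = x by rewrite (hf.1 7 isT).
apply: wp_asg; first by rewrite /= ed1; repeat split; apply: le_V; lia.
rewrite /= ed1; split; first by move: l1; rewrite sum_nat_const card_ord -sR; lia.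
by split=> // t ht; rewrite hF1 // take_size revK.
Qed.

Lemma wp_knapsack s X : inp s -> vr s rD = D -> uniq X ->
  (forall j, j \in X -> j < n) -> tables X s -> (forall i, ar s aF i = 0) ->
  wp V knapsack s (fun t s' =>
    t <= (\sum_(x < D.+1) (size (row X x) * (7 * D + 14) + 4)).+2 /\
    exists Kr, [/\ perm_eq Kr (keep X), sorted (fun i j => d j <= d i) Kr &
      ar s' aF D = dp (map nj Kr) D]).
Proof.
move=> hin eD uX nX hT h0; have hDm := dmax_maxval.
apply: wp_seq; apply: wp_asg => //=; set s0 := setv _ _ _.
have nK j : j \in keep X -> j < n.
  by move=> hk; apply: nX; apply: mem_subseq (keep_subseq J X) _ hk.
have uKp : uniq (keep X) by apply: subseq_uniq (keep_subseq J X) uX.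
apply: (@wp_for _ _ _ _ D.+1 (fun x s1 => vr s1 rd = x /\ exists Kr,
  [/\ perm_eq Kr [seq j <- keep X | d j < x], sorted (fun i j => d j <= d i) Kr &
    forall t, t <= D -> ar s1 aF t = dp (map nj Kr) t])
  (fun x => size (row X x) * (7 * D + 14) + 3)).
- split=> //; exists [::]; split=> // [|t ht]; last by rewrite /= h0.
  by rewrite (eq_filter (a2 := pred0)) ?filter_pred0.
- move=> x s1 hx [ed [Kr [pK sK hF]]] hf.
  have hin1 : inp s1 by exact: inp_frame hf hin.
  have eD1 : vr s1 rD = D by rewrite (hf.1 1 isT).
  have hT1 : tables X s1.
    case: hT => a1 a2 a3; split=> [y q h1 h2|y|y k h1].
    + by rewrite (hf.2 2 isT) a1.
    + by rewrite (hf.2 3 isT) a2.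
    + by rewrite (hf.2 4 isT) a3.
  have pK' : perm_eq (row X x ++ Kr) [seq j <- keep X | d j < x.+1].
    apply: perm_trans (_ : perm_eq _ (row X x ++ [seq j <- keep X | d j < x])) _.
      by rewrite perm_cat2l.
    apply: perm_trans (_ : perm_eq _ _) (permEl (perm_filterC (fun j => d j == x) _)).
    rewrite -!filter_predI; apply: perm_cat; apply/permP => a; congr (count a _);
      apply: eq_filter => j /=; lia.
  split=> //=.
  + by rewrite eD1; repeat split; apply: le_V; lia.
  + by rewrite ed eD1; case: ltnP => //; lia.
  apply: (wp_conseq (@wp_row s1 X Kr hin1 eD1 _ uX nX hT1 _ _ hF)); rewrite ?ed.
  + lia.
  + by rewrite (perm_uniq pK') filter_uniq.
  + by move=> k; rewrite (perm_mem pK) mem_filter => /andP [_ /nK].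
  move=> t s2 _ [l2 [ed2 hF2]]; split=> //; split; first by rewrite ed2 addn1.
  exists (row X x ++ Kr); split=> //.
  have tr : transitive (fun i j => d j <= d i) by move=> ? ? ? h1 h2; apply: leq_trans h2 h1.
  rewrite (sorted_pairwise tr) in sK; rewrite (sorted_pairwise tr) pairwise_cat sK andbT.
  apply/andP; split.
    apply/allrelP => i j; rewrite mem_filter (perm_mem pK) mem_filter.
    by move=> /andP [/eqP -> _] /andP [/ltnW].
  have : all (fun j => d j == x) (row X x) by apply: filter_all.
  elim: (row X x) => //= i r IH /andP [/eqP -> hr]; rewrite IH // andbT.
  by apply: sub_all hr => j /eqP ->.
- move=> s1 [ed _] hf; rewrite /= ed (hf.1 1 isT) /= eD addn1 ltnn; split=> //.
  by repeat split; apply: le_V; lia.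
- move=> t s1 ht [_ [Kr [pK sK hF]]] _; split.
    rewrite (eq_bigr (fun x : 'I_D.+1 => (size (row X x) * (7 * D + 14) + 3).+1)).
      by rewrite add1n ltnS.
    by move=> x _; rewrite addnS.
  exists Kr; split=> //; last exact: hF.
  apply: perm_trans pK _; rewrite (eq_in_filter (a2 := predT)) ?filter_predT //.
  by move=> j /nK /dmax_job; rewrite ltnS => ->.
Qed.

Lemma wp_algo s : inp s -> (forall a i, 0 < a -> ar s a i = 0) ->
  wp V algo s (fun t s' => is_opt J (vr s' 0) /\
    exists2 X, {in X, forall j, j < n} & t <= n * (7 * lg + 26) + 9 +
      (\sum_(x < D.+1) (size (row X x) * (7 * D + 14) + 4))).
Proof.
move=> hin h0; apply: wp_seq; apply: (wp_conseq (wp_scan hin)).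
move=> t1 s1 f1 [l1 eD1 eS1 hT1].
have hin1 : inp s1 by exact: inp_frame f1 hin.
have h1 a i : 1 < a -> ar s1 a i = 0.
  by move=> ha; rewrite f1.2 ?h0 //; [lia|rewrite !inE; lia].
apply: wp_seq; apply: (wp_conseq (wp_build hin1.1)) => t2 s2 f2 [l2 hh2 hT2].
have hin2 : inp s2 by exact: inp_frame f2 hin1.
have h2 a i : 1 < a -> ar s2 a i = 0.
  by move=> ha; rewrite f2.2 ?h1 //; rewrite !inE; lia.
have eD2 : vr s2 rD = D by rewrite (f2.1 1 isT).
apply: wp_seq; apply: (wp_conseq (@wp_select s2 hin2 eD2 hh2 _ h2)).
  by move=> i hi; rewrite hT2 ?hT1 // leq_addr.
move=> t3 s3 f3 [l3 [X [pX wX tX]]].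
have hin3 : inp s3 by exact: inp_frame f3 hin2.
have uX : uniq X by rewrite (perm_uniq pX) iota_uniq.
have eD3 : vr s3 rD = D by rewrite (f3.1 1 isT).
apply: wp_seq; apply: (wp_conseq (@wp_knapsack s3 X hin3 eD3 uX _ tX _)).
- by move=> j; rewrite (perm_mem pX) mem_iota.
- by move=> i; rewrite (f3.2 5 isT) h2.
move=> t4 s4 f4 [l4 [Kr [pK sK eF]]].
have eD4 : vr s4 rD = D by rewrite (f4.1 1 isT).
have eS4 : vr s4 rS = vr s1 rS by rewrite (f4.1 2 isT) (f3.1 2 isT) (f2.1 2 isT).
apply: wp_asg => //=; rewrite eD4 eF eS4 eS1; split; first exact: opt_value pX wX pK sK.
exists X; first by move=> j; rewrite (perm_mem pX) mem_iota.
rewrite mulnDr in l3; rewrite mulnDr.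
move: l4 l3 l2 l1; set A := \sum_(_ < _) _; set B := n * _; clearbody A B => *.
lia.
Qed.
End Algo.

(** * Running time *)

Lemma div_sum_mono x y m m' : x <= y -> m <= m' ->
  \sum_(q < m) x %/ q <= \sum_(q < m') y %/ q.
Proof.
move=> hx hm; rewrite -(big_mkord xpredT (fun q => x %/ q)) -(big_mkord xpredT (fun q => y %/ q)).
rewrite (big_cat_nat (n := m) (p := m')) //= (leq_trans _ (leq_addr _ _)) //.
by apply: leq_sum => q _; apply: leq_div2r.
Qed.

(** Only actual due dates have nonempty rows; this is where the factor [dnum] arises in place of
    [dmax]. *)
Lemma row_le J X x : {in X, forall j, j < size J} -> x <= dmax J ->
  size (row J X x) <= (x \in map jd J) * ((trunc_log 2 (dmax J)).+1 * dmax J).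
Proof.
move=> hX hx; have [hin|hout] := boolP (x \in map jd J).
  rewrite mul1n size_filter (leq_trans (keep_row _ _ _)) //.
  apply: leq_trans (harmonic _ _); apply: div_sum_mono => //.
  by rewrite (leq_ltn_trans hx) // trunc_log_ltn.
rewrite mul0n leqn0 size_filter -leqn0 leqNgt -has_count; apply: contra hout.
case/hasP=> j /(mem_subseq (keep_subseq J X)) /hX hj /eqP <-.
by apply: map_f; apply: mem_nth.
Qed.

Lemma sum_mem_le m (s : seq nat) : \sum_(x < m) ((x : nat) \in s) <= size (undup s).
Proof.
have -> : \sum_(x < m) ((x : nat) \in s) = count (mem s) (iota 0 m).
  rewrite -sum1_count [RHS]big_mkcond /= -[m in iota 0 m]subn0 -/(index_iota 0 m) big_mkord.
  by apply: eq_bigr.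
rewrite -size_filter; apply: uniq_leq_size; first exact/filter_uniq/iota_uniq.
by move=> x; rewrite mem_filter mem_undup => /andP [].
Qed.

Lemma rows_le J X : {in X, forall j, j < size J} ->
  \sum_(x < (dmax J).+1) (size (row J X x) * (7 * dmax J + 14) + 4) <=
  21 * (trunc_log 2 (dmax J)).+1 * (dnum J * dmax J ^ 2) + 4 * (dmax J).+1.
Proof.
move=> hX; set D := dmax J; set k := (trunc_log 2 D).+1.
rewrite big_split /= sum_nat_const card_ord [_ * 4]mulnC leq_add2r -big_distrl /=.
have h : \sum_(x < D.+1) size (row J X x) <= dnum J * (k * D).
  apply: leq_trans (_ : \sum_(x < D.+1) ((x : nat) \in map jd J) * (k * D) <= _).
    by apply: leq_sum => x _; apply: row_le => //; rewrite -ltnS.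
  by rewrite -big_distrl leq_mul2r sum_mem_le orbT.
apply: leq_trans (leq_mul h (leqnn _)) _.
(* The constant is [7 + 14], since [14 * D <= 14 * D ^ 2]. *)
have hD : D * (7 * D + 14) <= 21 * D ^ 2.
  by rewrite mulnCA leq_mul2l; case: (posnP D) => [->//|hD]; apply/orP; right; lia.
apply: leq_trans (_ : dnum J * k * (D * (7 * D + 14)) <= _).
  by rewrite !mulnA.
apply: leq_trans (leq_mul (leqnn _) hD) _.
by rewrite leq_eqVlt; apply/orP; left; apply/eqP; lia.
Qed.

Lemma time_le J X : 0 < size J -> {in X, forall j, j < size J} ->
  size J + (size J * (7 * (trunc_log 2 (size J)).+1 + 26) + 9 +
    \sum_(x < (dmax J).+1) (size (row J X x) * (7 * dmax J + 14) + 4)) + 1 <=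
  100 * ((size J + dnum J * dmax J ^ 2 + 1) * trunc_log 2 (size J + dmax J + 2)).
Proof.
move=> hn /rows_le; set D := dmax J; set n := size J; set l := trunc_log 2 (n + D + 2).
move=> hr; have l0 : 0 < l by rewrite trunc_log_gt0; lia.
have ln : (trunc_log 2 n).+1 <= 2 * l.
  by have : trunc_log 2 n <= l; [apply: leq_trunc_log|]; lia.
have lD : (trunc_log 2 D).+1 <= 2 * l.
  by have : trunc_log 2 D <= l; [apply: leq_trunc_log|]; lia.
(* This absorbs the visits to all dates up to [D]: a nonempty instance has at least one due date. *)
have hE : D <= dnum J * D ^ 2.
  have d0 : 0 < dnum J.
    by rewrite /dnum; case: (J) hn => [|j J'] // _; rewrite -has_predT; apply/hasP;
       exists (jd j) => //; rewrite mem_undup /= mem_head.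
  by apply: leq_trans (leq_pmull _ d0); rewrite expnS expn1; case: (D) => // e; rewrite leq_pmulr.
set E := dnum J * D ^ 2 in hr hE *.
have h1 : n * (7 * (trunc_log 2 n).+1 + 26) <= n * (40 * l) by rewrite leq_mul2l; lia.
have h2 : 21 * (trunc_log 2 D).+1 * E <= 42 * l * E by rewrite leq_mul2r; lia.
have h3 : n <= n * l by rewrite leq_pmulr.
have h4 : E <= E * l by rewrite leq_pmulr.
by rewrite !mulnDl !mulnDr; lia.
Qed.

Lemma init_mem_le J x : init_mem J x <= size J + maxval J.
Proof.
rewrite /init_mem; case: eqP => _; first exact: leq_addr.
case: ifP => // h; have [h1 h2 h3] := maxval_job h; rewrite /nj in h1 h2 h3.
by apply: leq_trans (leq_addl _ _); case: eqP => // _; case: eqP.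
Qed.

Theorem theorem5 :
  exists (P : seq instr) (c C k : nat), forall J : seq job,
    exists M' : memory,
      run (word_bound c J) P
          (C * (size J + dnum J * dmax J ^ 2 + 1) * (trunc_log 2 (size J + dmax J + 2)) ^ k)
          0 (init_mem J) = Some M'
      /\ is_opt J (M' 0).
Proof.
(* [K] is the factor demanded by [program_run]; the 100 below is the constant of [time_le]. *)
pose K := size (compC algo 89) + 400.
exists (program algo), 20, (K * 100), 1 => J; rewrite expn1.
case: (posnP (size J)) => hn.
  have {hn}-> : J = [::] by apply: size0nil.
  exists (init_mem [::]); split; last first.
    by split=> [|s _]; [exists [::]|].
  apply: (@run_steps _ _ 1 (0, init_mem [::]) (size (program algo))).
  - by apply: steps_step (steps_refl _ _ _).
  - exact: nth_default.
  - by rewrite /dnum /dmax big_nil /= /K -[trunc_log 2 _]/1; lia.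
set N := size J + maxval J + 2; have hN : 2 <= N by rewrite /N leq_addl.
(* As [N >= 2], surplus powers of [N] absorb the constants: [N ^ 10 >= 1024] for values,
   [N ^ 11 >= 2048] for the relocation, and a further [N ^ 8 >= 256] leads from [V] to the word
   bound [N ^ 20]. *)
pose V := N ^ 12.
have e10 m : 2 ^ m <= N ^ m by case: m => // m; rewrite leq_exp2r.
have hV a b c : a <= 4 * N -> b <= 4 * N -> c <= 4 * N -> a * b + c < V.
  move=> ha hb hc.
  have h : a * b <= 4 * N * (4 * N) by apply: leq_mul.
  have -> : V = N * N * N ^ 10 by rewrite /V -mulnA -!expnS.
  have h2 : N * N * 1024 <= N * N * N ^ 10 by rewrite leq_mul2l (e10 10) orbT.
  have h3 : N * 2 <= N * N by rewrite leq_mul2l hN orbT.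
  lia.
have hV2 : 1024 * size J + 1024 <= V.
  have -> : V = N * N ^ 11 by rewrite /V -expnS.
  have h : N * 2048 <= N * N ^ 11 by rewrite leq_mul2l (e10 11) orbT.
  by rewrite /N in h *; lia.
have hinit x : init_mem J x < V.
  apply: leq_ltn_trans (init_mem_le J x) _.
  by have := @hV 0 0 N; rewrite mul0n /N => h; apply: leq_ltn_trans (h _ _ _); lia.
have hB : 16 * V + 512 * size J + 16 <= word_bound 20 J.
  have -> : word_bound 20 J = V * N ^ 8 by rewrite /V -expnD.
  have h : V * 256 <= V * N ^ 8 by rewrite leq_mul2l (e10 8) orbT.
  by lia.
set F := (size J + dnum J * dmax J ^ 2 + 1) * trunc_log 2 (size J + dmax J + 2).
(* The algorithm is granted what remains of [100 * F] after [size J + 1], so that the fuel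
   [K * (size J + T + 1)] fits into [K * (100 * F)]. *)
apply: (@program_run algo J V _ wf_algo hn hV2 hinit hB (100 * F - (size J + 1)) (is_opt J)).
  move=> s h0 hIn hz _; have hin := inp_init hn h0 hIn.
  have [t [s' [he [ho [X nX ht]]]]] := wp_algo hn hV hin hz.
  exists t, s'; split=> //; apply: leq_trans ht _.
  by have := time_le hn nX; rewrite -/F; lia.
rewrite -!mulnA -/F leq_mul2l; apply/orP; right.
have : size J + 1 <= F.
  have l0 : 0 < trunc_log 2 (size J + dmax J + 2) by rewrite trunc_log_gt0; lia.
  by apply: leq_trans (leq_pmulr _ l0); lia.
by lia.
Qed.
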